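(* Globally optimal outer measures exist; that is, for every integer $n\ge1$ there exists a globally optimal outer measure on $\mathbb{R}^n$.
   Context: Here $\mathbb{N}=\{0,1,2,\ldots\}$. An outer measure on $\mathbb{R}^n$ is a function $\mu:\mathcal{P}(\mathbb{R}^n)\to[0,\infty]$ with $\mu(\emptyset)=0$ that is monotone and countably subadditive. It is *supported on $\mathbb{Q}^n$* if $\mu(\mathbb{R}^n\setminus\mathbb{Q}^n)=0$. It is *finitely supported on $\mathbb{Q}^n$* if for every $\varepsilon>0$ there is a finite set $A\subseteq\mathbb{Q}^n$ with $\mu(\mathbb{R}^n\setminus A)<\varepsilon$. It is *strongly finite* if it is supported on $\mathbb{Q}^n$ and $\sum_{q\in\mathbb{Q}^n}\mu(\{q\})<\infty$. It is *lower semicomputable* if it is finitely supported on $\mathbb{Q}^n$ and there is a computable function $\hat\mu:\mathcal{P}^{<\omega}(\mathbb{Q}^n)\times\mathbb{N}\to\mathbb{Q}\cap[0,\infty)$ (where $\mathcal{P}^{<\omega}(\mathbb{Q}^n)$ is the set of all finite subsets of $\mathbb{Q}^n$) such that for all finite $A\subseteq\mathbb{Q}^n$: (i) $\hat\mu(A,s)\le\hat\mu(A,t)\le\mu(A)$ whenever $s\le t$; (ii) $\lim_{t\to\infty}\hat\mu(A,t)=\mu(A)$. An outer measure $\mu$ on $\mathbb{R}^n$ is *globally optimal* if (i) $\mu$ is strongly finite and lower semicomputable, and (ii) for every strongly finite, lower semicomputable outer measure $\nu$ on $\mathbb{R}^n$ there is a constant $\beta\in(0,\infty)$ such that $\mu(E)\ge\beta\cdot\nu(E)$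 for all $E\subseteq\mathbb{R}^n$. *)

(* Defs.v *)
From HB Require Import structures.
From mathcomp Require Import all_boot all_order all_algebra finmap.
From mathcomp Require Import all_classical all_reals all_analysis.
Import Order.TTheory GRing.Theory Num.Theory.
Import numFieldNormedType.Exports.

Set Implicit Arguments.
Unset Strict Implicit.
Unset Printing Implicit Defensive.

Local Open Scope classical_set_scope.
Local Open Scope ring_scope.

(* General recursive functions in the sense of Kleene: the least class of total
   functions containing zero, successor and the projections and closed under
   composition, primitive recursion and minimization of regular functions.
   Each schema is given by its defining equations, which determine h. *)
Inductive recursive : forall k : nat, (k.-tuple nat -> nat) -> Prop :=
| rec_zero k (h : k.-tuple nat -> nat) :
    (forall v, h v = 0%N) -> recursive h
| rec_succ (h : 1.-tuple nat -> nat) :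
    (forall x, h [tuple x] = x.+1) -> recursive h
| rec_proj k (i : 'I_k) (h : k.-tuple nat -> nat) :
    (forall v, h v = tnth v i) -> recursive h
| rec_comp k m (f : k.-tuple nat -> nat) (g : 'I_k -> m.-tuple nat -> nat)
      (h : m.-tuple nat -> nat) :
    recursive f -> (forall i, recursive (g i)) ->
    (forall v, h v = f [tuple g i v | i < k]) -> recursive h
| rec_prim k (f : k.-tuple nat -> nat) (g : k.+2.-tuple nat -> nat)
      (h : k.+1.-tuple nat -> nat) :
    recursive f -> recursive g ->
    (forall v : k.-tuple nat, h [tuple of 0%N :: v] = f v) ->
    (forall x (v : k.-tuple nat), h [tuple of x.+1 :: v] =
                 g [tuple of x :: h [tuple of x :: v] :: v]) ->
    recursive h
| rec_min k (f : k.+1.-tuple nat -> nat) (h : k.-tuple nat -> nat) :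
    recursive f ->
    (forall v : k.-tuple nat, f [tuple of h v :: v] = 0%N) ->
    (forall (v : k.-tuple nat) y, (y < h v)%N -> f [tuple of y :: v] <> 0%N) ->
    recursive h.

(* Numberings of Q, Q^n and the finite subsets of Q^n by natural numbers, based
   on the bijection CodeSeq.decode : nat -> seq nat.  Every natural number is a
   name; missing list entries are read as 0. *)
Definition rat_of_code (c : nat) : rat :=
  let s := CodeSeq.decode c in
  ((nth 0%N s 0)%:R - (nth 0%N s 1)%:R) / (nth 0%N s 2).+1%:R.

Definition ratvec_of_code (n c : nat) : 'rV[rat]_n :=
  \row_(i < n) rat_of_code (nth 0%N (CodeSeq.decode c) i).

Definition ratset_of_code (n c : nat) : {fset 'rV[rat]_n} :=
  [fset x in [seq ratvec_of_code n d | d <- CodeSeq.decode c]]%fset.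

Lemma rat_of_code_surj (q : rat) : exists c, rat_of_code c = q.
Proof.
have qE : q = (numq q)%:~R / (absz (denq q)).-1.+1%:R.
  rewrite prednK ?absz_gt0 ?denq_neq0// -[LHS]divq_num_den.
  by rewrite -[in LHS](absz_denq q).
case: (numq q) qE => a qE; [exists (CodeSeq.code [:: a; 0; (absz (denq q)).-1])%N
  | exists (CodeSeq.code [:: 0; a.+1; (absz (denq q)).-1])%N];
  rewrite /rat_of_code CodeSeq.codeK [RHS]qE /=.
- by rewrite subr0.
- by rewrite sub0r NegzE mulrNz.
Qed.

Lemma ratvec_of_code_surj (n : nat) (x : 'rV[rat]_n) :
  exists c, ratvec_of_code n c = x.
Proof.
have /choice[c cE] := rat_of_code_surj.
exists (CodeSeq.code [seq c (x 0 i) | i <- enum 'I_n]).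
apply/rowP => i; rewrite mxE CodeSeq.codeK.
by rewrite (nth_map i) ?size_enum_ord// nth_ord_enum cE.
Qed.

Lemma ratset_of_code_surj (n : nat) (A : {fset 'rV[rat]_n}) :
  exists c, ratset_of_code n c = A.
Proof.
have /choice[c cE] := @ratvec_of_code_surj n.
exists (CodeSeq.code [seq c x | x <- enum_fset A]).
apply/fsetP => x; rewrite !inE CodeSeq.codeK -map_comp.
by rewrite (eq_map (g := id)) ?map_id// => y /=; rewrite cE.
Qed.

Definition computable (n : nat) (F : {fset 'rV[rat]_n} -> nat -> rat) : Prop :=
  exists2 f : 2.-tuple nat -> nat, recursive f &
    forall a t, rat_of_code (f [tuple a; t]) = F (ratset_of_code n a) t.

Section OuterMeasures.
Variables (R : realType) (n : nat).
Implicit Types mu nu : {outer_measure set 'rV[R]_n -> \bar R}.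

Definition ratpoint (q : 'rV[rat]_n) : 'rV[R]_n := map_mx ratr q.

Definition Qn : set 'rV[R]_n := range ratpoint.

Definition ratset (A : {fset 'rV[rat]_n}) : set 'rV[R]_n :=
  ratpoint @` [set` A].

Definition supported_on_Qn mu : Prop := mu (~` Qn) = 0%E.

Definition finitely_supported_on_Qn mu : Prop :=
  forall eps : R, 0 < eps ->
    exists A : {fset 'rV[rat]_n}, (mu (~` ratset A) < eps%:E)%E.

Definition strongly_finite mu : Prop :=
  supported_on_Qn mu /\ (\esum_(q in Qn) mu [set q] < +oo)%E.

Definition lower_semicomputable mu : Prop :=
  finitely_supported_on_Qn mu /\
  exists muhat : {fset 'rV[rat]_n} -> nat -> rat,
    [/\ computable muhat,
        forall A t, 0 <= muhat A t,
        forall A s t, (s <= t)%N ->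
          muhat A s <= muhat A t /\
          ((ratr (muhat A t) : R)%:E <= mu (ratset A))%E
      & forall A, (ratr (muhat A t) : R)%:E @[t --> \oo] --> mu (ratset A)].

Definition globally_optimal mu : Prop :=
  [/\ strongly_finite mu, lower_semicomputable mu
    & forall nu, strongly_finite nu -> lower_semicomputable nu ->
        exists2 beta : R, 0 < beta & forall E, (beta%:E * nu E <= mu E)%E].

End OuterMeasures.

(* Main.v *)
(* The optimal outer measure is a weighted sum of outer measures with total
   point mass at most 1, one for each index e = (p, k), where p is a program in a
   universal enumeration of the recursive functions and k a scaling exponent.

   At stage t the derivations coded by numbers below t give lower bounds, divided
   by 2^k and rounded down to multiples of 2^-t, for the values of program p on
   finite sets.  These bounds need not be subadditive; they are replaced by the
   largest outer measure below them, namely the least total bound of a family of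
   sets covering the given one.  The result increases with t, and it is frozen at
   the last stage where its total point mass is at most 1.  Everything is a
   finite computation, so the sum is lower semicomputable, and strong finiteness
   implies finite support.

   If p approximates nu and sum_q nu {q} <= 2^k, no freezing occurs.  Given a
   finite set A, at a late stage the bound of every subset C of A is at least half
   of nu C / 2^k; this slack is multiplicative, so it survives the summation over
   a covering family of unbounded size, and subadditivity of nu bounds the covers
   of A from below by nu A / 2^(k+1).  The passage from finite to arbitrary sets
   uses that nu is finitely supported. *)
From HB Require Import structures.
Require Import Defs.
From mathcomp Require Import all_boot all_order all_algebra finmap lra ring.
From mathcomp Require Import all_classical all_reals all_analysis.
Import Order.TTheory GRing.Theory Num.Theory.
Import numFieldNormedType.Exports.

Set Implicit Arguments.
Unset Strict Implicit.
Unset Printing Implicit Defensive.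

Local Open Scope nat_scope.

(** * Closure properties of the recursive functions *)

(* A function of finitely many variables is written as a function of the list
   of its arguments; missing arguments are read as 0. *)
Definition Rec (F : seq nat -> nat) : Prop :=
  forall k, recursive (fun v : k.-tuple nat => F v).

Lemma eq_Rec F G : F =1 G -> Rec F -> Rec G.
Proof. by move=> /funext ->. Qed.

(** The composition schema fixes the arity of the outer function, so the argument list must have the
    same length [m] for every [v]; only its entries need to be recursive. *)
Lemma recursive_comp F k m (L : k.-tuple nat -> seq nat) : Rec F ->
  (forall v, size (L v) = m) ->
  (forall i, i < m -> recursive (fun v => nth 0 (L v) i)) ->
  recursive (fun v => F (L v)).
Proof.
move=> RF sL RL.
apply: (@rec_comp m k _ (fun i v => nth 0 (L v) i)) (RF m) _ _.
  by move=> i; apply: RL.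
move=> v; congr F; apply: (@eq_from_nth _ 0); rewrite ?size_tuple// sL => i im.
by rewrite -[i]/(nat_of_ord (Ordinal im)) -tnth_nth tnth_mktuple.
Qed.

Lemma Rec_nth i : Rec (fun s => nth 0 s i).
Proof.
move=> k; have [ik|ki] := ltnP i k.
  by apply: (rec_proj (i := Ordinal ik)) => v; rewrite (tnth_nth 0).
by apply: rec_zero => v; rewrite nth_default// size_tuple.
Qed.

Lemma Rec_subst F (gs : seq (seq nat -> nat)) : Rec F ->
  (forall i, i < size gs -> Rec (nth (fun=> 0) gs i)) ->
  Rec (fun s => F [seq g s | g <- gs]).
Proof.
move=> RF Rgs k.
apply: (recursive_comp (m := size gs) RF) => [v|i im]; first by rewrite size_map.
rewrite (_ : (fun _ => _) = fun v : k.-tuple nat => nth (fun=> 0) gs i v).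
  exact: Rgs.
by apply: funext => v; rewrite (nth_map (fun=> 0)).
Qed.

(** The body reads the step index and the partial result as the first two entries of its list; the
    parameters follow, in the order that primitive recursion uses. *)
Lemma Rec_iteri N x0 G :
  Rec N -> Rec x0 ->
  Rec (fun s => G (nth 0 s 0) (nth 0 s 1) (behead (behead s))) ->
  Rec (fun s => iteri (N s) (fun i z => G i z s) (x0 s)).
Proof.
move=> RN Rx0 RG k.
pose h (v : k.+1.-tuple nat) :=
  iteri (thead v) (fun i z => G i z (behead v)) (x0 (behead v)).
have Rh : recursive h.
  apply: (@rec_prim k (fun v => x0 v)
    (fun v => G (nth 0 v 0) (nth 0 v 1) (behead (behead v)))) => //.
(* The count [N v], put in front of the parameters, becomes the recursion argument. *)
pose g (i : 'I_k.+1) (v : k.-tuple nat) := nth 0 (N v :: v) i.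
apply: (@rec_comp k.+1 k h g) => // [[[|i] ik]|v].
- exact: RN.
- exact: Rec_nth.
rewrite (_ : [tuple _ | _ < _] = [tuple of N v :: v])//.
by apply/eq_from_tnth => i; rewrite tnth_mktuple (tnth_nth 0).
Qed.

Lemma Rec_S a : Rec a -> Rec (fun s => (a s).+1).
Proof.
move=> Ra k; apply: (@rec_comp 1 k (fun v => (thead v).+1) (fun _ v => a v)).
- exact: rec_succ.
- by move=> _; exact: Ra.
- by move=> v; rewrite /thead tnth_mktuple.
Qed.

Lemma Rec_const c : Rec (fun=> c).
Proof.
elim: c => [|c IHc]; last exact: Rec_S.
by move=> k; apply: rec_zero.
Qed.

(** Variables are de Bruijn indices: under [d] bound variables the outer arguments are reached
    through [d] applications of [behead]. *)
Lemma Rec_var d i : Rec (fun s => nth 0 (iter d behead s) i).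
Proof.
apply: eq_Rec (Rec_nth (i + d)) => s.
by elim: d i => [|d IHd] i; rewrite ?addn0// iterS nth_behead -IHd addnS.
Qed.

Lemma Rec_behead F : Rec F -> Rec (fun s => F (behead s)).
Proof.
move=> RF k; apply: (recursive_comp (m := k.-1) RF) => [v|i _].
  by rewrite size_behead size_tuple.
exact: (Rec_var 1 i).
Qed.

Lemma Rec_subst1 f a : Rec (fun s => f (nth 0 s 0)) -> Rec a ->
  Rec (fun s => f (a s)).
Proof.
by move=> Rf Ra; apply: (Rec_subst (gs := [:: a])) Rf _; case.
Qed.

Lemma Rec_subst2 f a b : Rec (fun s => f (nth 0 s 0) (nth 0 s 1)) ->
  Rec a -> Rec b -> Rec (fun s => f (a s) (b s)).
Proof.
by move=> Rf Ra Rb; apply: (Rec_subst (gs := [:: a; b])) Rf _ => -[|[]].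
Qed.

Lemma Rec_subst3 f a b c :
  Rec (fun s => f (nth 0 s 0) (nth 0 s 1) (nth 0 s 2)) ->
  Rec a -> Rec b -> Rec c -> Rec (fun s => f (a s) (b s) (c s)).
Proof.
move=> Rf Ra Rb Rc; apply: (Rec_subst (gs := [:: a; b; c])) Rf _.
by move=> -[|[|[]]].
Qed.

Lemma Rec_subst4 f a b c d :
  Rec (fun s => f (nth 0 s 0) (nth 0 s 1) (nth 0 s 2) (nth 0 s 3)) ->
  Rec a -> Rec b -> Rec c -> Rec d -> Rec (fun s => f (a s) (b s) (c s) (d s)).
Proof.
move=> Rf Ra Rb Rc Rd; apply: (Rec_subst (gs := [:: a; b; c; d])) Rf _.
by move=> -[|[|[|[]]]].
Qed.

Lemma Rec_iter N x0 G : Rec N -> Rec x0 ->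
  Rec (fun s => G (nth 0 s 0) (behead s)) ->
  Rec (fun s => iter (N s) (fun z => G z s) (x0 s)).
Proof.
move=> RN Rx0 RG.
apply: (@eq_Rec (fun s => iteri (N s) (fun _ z => G z s) (x0 s))) => [s|].
  by elim: (N s) => //= m ->.
by apply: Rec_iteri => //; apply: eq_Rec (Rec_behead RG) => s; rewrite nth_behead.
Qed.

(** * Arithmetic and Boolean operations *)

Lemma Rec_pred a : Rec a -> Rec (fun s => (a s).-1).
Proof.
apply: Rec_subst1.
(* The predecessor is the last step index of the iteration, which ignores its partial result. *)
apply: (@eq_Rec (fun s => iteri (nth 0 s 0) (fun i _ => i) 0)) => [s|].
  by case: (nth 0 s 0).
apply: (Rec_iteri (G := fun i _ _ => i)); first exact: Rec_nth.
  exact: Rec_const.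
exact: Rec_nth.
Qed.

Lemma Rec_add a b : Rec a -> Rec b -> Rec (fun s => a s + b s).
Proof.
apply: (@Rec_subst2 addn).
apply: (@eq_Rec (fun s => iter (nth 0 s 0) S (nth 0 s 1))) => [s|].
  by elim: (nth 0 s 0) => //= m ->.
apply: (Rec_iter (G := fun z _ => z.+1)); try exact: Rec_nth.
by apply: Rec_S; exact: Rec_nth.
Qed.

Lemma Rec_mul a b : Rec a -> Rec b -> Rec (fun s => a s * b s).
Proof.
apply: (@Rec_subst2 muln).
apply: (@eq_Rec (fun s => iter (nth 0 s 0) (fun z => nth 0 s 1 + z) 0)) => [s|].
  by elim: (nth 0 s 0) => //= m ->; rewrite mulSn.
apply: (Rec_iter (G := fun z s => nth 0 s 1 + z)); first exact: Rec_nth.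
  exact: Rec_const.
by apply: Rec_add; [exact: (Rec_var 1 1)|exact: Rec_nth].
Qed.

Lemma Rec_sub a b : Rec a -> Rec b -> Rec (fun s => a s - b s).
Proof.
apply: (@Rec_subst2 subn).
apply: (@eq_Rec (fun s => iter (nth 0 s 1) predn (nth 0 s 0))) => [s|].
  by elim: (nth 0 s 1) => [|m]; rewrite ?subn0//= => ->; rewrite subnS.
apply: (Rec_iter (G := fun z _ => z.-1)); try exact: Rec_nth.
by apply: Rec_pred; exact: Rec_nth.
Qed.

Lemma Rec_exp2 a : Rec a -> Rec (fun s => 2 ^ a s).
Proof.
apply: (@Rec_subst1 (expn 2)).
apply: (@eq_Rec (fun s => iter (nth 0 s 0) (fun z => z + z) 1)) => [s|].
  by elim: (nth 0 s 0) => //= m ->; rewrite expnS mul2n addnn.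
apply: (Rec_iter (G := fun z _ => z + z)); first exact: Rec_nth.
  exact: Rec_const.
by apply: Rec_add; exact: Rec_nth.
Qed.

Lemma Rec_negb (a : seq nat -> bool) : Rec a -> Rec (fun s => ~~ a s).
Proof.
move=> Ra; apply: (@eq_Rec (fun s => 1 - a s)) => [s|]; first by case: (a s).
by apply: Rec_sub => //; exact: Rec_const.
Qed.

Lemma Rec_eq0 a : Rec a -> Rec (fun s => a s == 0).
Proof.
move=> Ra; apply: (@eq_Rec (fun s => 1 - a s)) => [s|].
  by case: (a s) => // m; rewrite subSS sub0n.
by apply: Rec_sub => //; exact: Rec_const.
Qed.

Lemma Rec_leq a b : Rec a -> Rec b -> Rec (fun s => a s <= b s).
Proof. by move=> Ra Rb; apply/Rec_eq0/Rec_sub. Qed.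

Lemma Rec_andb (a b : seq nat -> bool) : Rec a -> Rec b ->
  Rec (fun s => a s && b s).
Proof.
move=> Ra Rb; apply: (@eq_Rec (fun s => a s * b s)) => [s|]; last exact: Rec_mul.
by rewrite mulnb.
Qed.

Lemma Rec_orb (a b : seq nat -> bool) : Rec a -> Rec b ->
  Rec (fun s => a s || b s).
Proof.
move=> Ra Rb; apply: (@eq_Rec (fun s => ~~ (~~ a s && ~~ b s))) => [s|].
  by rewrite negb_and !negbK.
by apply/Rec_negb/Rec_andb; exact: Rec_negb.
Qed.

Lemma Rec_implyb (a b : seq nat -> bool) : Rec a -> Rec b ->
  Rec (fun s => a s ==> b s).
Proof.
move=> Ra Rb; apply: (@eq_Rec (fun s => ~~ a s || b s)) => [s|].
  by rewrite implybE.
by apply/Rec_orb => //; exact: Rec_negb.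
Qed.

Lemma Rec_eqn a b : Rec a -> Rec b -> Rec (fun s => a s == b s).
Proof.
move=> Ra Rb; apply: (@eq_Rec (fun s => (a s <= b s) && (b s <= a s))) => [s|].
  by rewrite -eqn_leq.
by apply: Rec_andb; exact: Rec_leq.
Qed.

Lemma Rec_if (c : seq nat -> bool) a b : Rec c -> Rec a -> Rec b ->
  Rec (fun s => if c s then a s else b s).
Proof.
move=> Rc Ra Rb; apply: (@eq_Rec (fun s => c s * a s + (~~ c s) * b s)) => [s|].
  by case: (c s); rewrite ?mul1n ?mul0n ?addn0.
by apply: Rec_add; apply: Rec_mul => //; exact: Rec_negb.
Qed.

Lemma Rec_ifb (c a b : seq nat -> bool) : Rec c -> Rec a -> Rec b ->
  Rec (fun s => (if c s then a s else b s) : bool).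
Proof.
move=> Rc Ra Rb; apply: eq_Rec (Rec_if Rc Ra Rb) => s; by case: (c s).
Qed.

Lemma Rec_minn a b : Rec a -> Rec b -> Rec (fun s => minn (a s) (b s)).
Proof. by move=> Ra Rb; apply: Rec_if => //; apply/Rec_leq => //; exact: Rec_S. Qed.

Lemma Rec_maxn a b : Rec a -> Rec b -> Rec (fun s => maxn (a s) (b s)).
Proof. by move=> Ra Rb; apply: Rec_if => //; apply/Rec_leq => //; exact: Rec_S. Qed.

(* Moves the body of a bounded operator below the extra variable holding the
   partial result in [Rec_iteri]. *)
Lemma Rec_skip F : Rec F -> Rec (fun s => F (nth 0 s 0 :: behead (behead s))).
Proof.
move=> RF k.
apply: (recursive_comp (m := k.-2.+1) RF) => [v|[|i] _].
- by rewrite /= !size_behead size_tuple.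
- exact: Rec_nth.
- exact: (Rec_var 2 i).
Qed.

(** * Bounded sums, extrema and quantifiers *)

Lemma Rec_sum N F : Rec N -> Rec (fun s => F (nth 0 s 0) (behead s)) ->
  Rec (fun s => \sum_(0 <= i < N s) F i s).
Proof.
move=> RN RF; apply: (@eq_Rec (fun s => iteri (N s) (fun i z => z + F i s) 0)).
  by move=> s; elim: (N s) => [|m IHm]; [rewrite big_geq|rewrite big_nat_recr//= IHm].
apply: Rec_iteri => //; first exact: Rec_const.
by apply: Rec_add; [exact: Rec_nth|exact: (Rec_skip RF)].
Qed.

Lemma Rec_max N F : Rec N -> Rec (fun s => F (nth 0 s 0) (behead s)) ->
  Rec (fun s => \max_(0 <= i < N s) F i s).
Proof.
move=> RN RF; apply: (@eq_Rec (fun s => iteri (N s) (fun i z => maxn z (F i s)) 0)).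
  by move=> s; elim: (N s) => [|m IHm]; [rewrite big_geq|rewrite big_nat_recr//= IHm].
apply: Rec_iteri => //; first exact: Rec_const.
by apply: Rec_maxn; [exact: Rec_nth|exact: (Rec_skip RF)].
Qed.

(** A minimum over an empty range has no neutral element in the natural numbers; [z] supplies the
    starting value. *)
Definition bmin (m z : nat) (F : nat -> nat) := iteri m (fun i y => minn y (F i)) z.

Lemma Rec_bmin N x F : Rec N -> Rec x -> Rec (fun s => F (nth 0 s 0) (behead s)) ->
  Rec (fun s => bmin (N s) (x s) (fun i => F i s)).
Proof.
move=> RN Rx RF; apply: Rec_iteri => //.
by apply: Rec_minn; [exact: Rec_nth|exact: (Rec_skip RF)].
Qed.

Definition all_lt (m : nat) (P : pred nat) := all P (iota 0 m).
Definition has_lt (m : nat) (P : pred nat) := has P (iota 0 m).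

Lemma all_ltP m (P : pred nat) : reflect (forall i, i < m -> P i) (all_lt m P).
Proof.
apply: (iffP allP) => H i; first by move=> im; apply: H; rewrite mem_iota.
by rewrite mem_iota => /andP[_]; exact: H.
Qed.

Lemma has_ltP m (P : pred nat) : reflect (exists2 i, i < m & P i) (has_lt m P).
Proof.
apply: (iffP hasP) => -[i im Pi]; exists i => //; first by rewrite mem_iota in im.
by rewrite mem_iota.
Qed.

Lemma Rec_has_lt N (F : nat -> pred (seq nat)) : Rec N ->
  Rec (fun s => F (nth 0 s 0) (behead s)) ->
  Rec (fun s => has_lt (N s) (fun i => F i s)).
Proof.
move=> RN RF; apply: (@eq_Rec (fun s => \max_(0 <= i < N s) F i s)).
  move=> s; rewrite /has_lt; elim: (N s) => [|m IHm]; first by rewrite big_geq.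
  rewrite -addn1 iotaD has_cat /= addn1 big_nat_recr//= IHm orbF.
  by case: (has _ _); case: (F m s).
exact: (Rec_max (F := fun i s => nat_of_bool (F i s))).
Qed.

Lemma Rec_all_lt N (F : nat -> pred (seq nat)) : Rec N ->
  Rec (fun s => F (nth 0 s 0) (behead s)) ->
  Rec (fun s => all_lt (N s) (fun i => F i s)).
Proof.
move=> RN RF; apply: (@eq_Rec (fun s => ~~ has_lt (N s) (fun i => ~~ F i s))) => [s|].
  by rewrite -all_predC; congr (nat_of_bool _); apply: eq_all => i /=; rewrite negbK.
by apply/Rec_negb/Rec_has_lt => //; exact: Rec_negb.
Qed.

Create HintDb rec discriminated.
#[local] Hint Constants Opaque : rec.
#[local] Hint Resolve Rec_const Rec_S Rec_pred Rec_add Rec_mul Rec_sub Rec_exp2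
  Rec_negb Rec_eq0 Rec_leq Rec_andb Rec_orb Rec_implyb Rec_eqn Rec_if Rec_ifb Rec_sum
  Rec_max Rec_bmin Rec_has_lt Rec_all_lt : rec.
#[local] Hint Extern 0 (Rec (fun s => nth _ s _)) => exact: (Rec_var 0 _) : rec.
#[local] Hint Extern 0 (Rec (fun s => nth _ (behead s) _)) =>
  exact: (Rec_var 1 _) : rec.
#[local] Hint Extern 0 (Rec (fun s => nth _ (behead (behead s)) _)) =>
  exact: (Rec_var 2 _) : rec.
#[local] Hint Extern 0 (Rec (fun s => nth _ (behead (behead (behead s))) _)) =>
  exact: (Rec_var 3 _) : rec.
Ltac rec := auto 100 with rec nocore.

(** Presents a number as a count of the indices below it; quotients, heads and lengths of coded
    lists thereby become bounded sums of decidable tests. *)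
Lemma sum_ltn m k : k <= m -> \sum_(0 <= i < m) (i < k) = k.
Proof.
move=> km; rewrite (@big_cat_nat _ _ _ k)//=.
rewrite (eq_big_nat _ _ (F2 := fun=> 1)) => [|i /andP[_ ->]//].
rewrite sum_nat_const_nat subn0 muln1 big_nat big1 ?addn0// => i /andP[ki _].
by rewrite ltnNge ki.
Qed.

Lemma Rec_div a b : Rec a -> Rec b -> Rec (fun s => a s %/ b s).
Proof.
apply: (@Rec_subst2 divn).
(* The quotient counts the positive multiples of the divisor up to the dividend; the first factor
   gives 0 on division by 0. *)
apply: (@eq_Rec (fun s => (0 < nth 0 s 1) *
    \sum_(0 <= i < nth 0 s 0) (i.+1 * nth 0 s 1 <= nth 0 s 0))); last by rec.
move=> s; case: (nth 0 s 1) => [|d]; first by rewrite divn0.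
rewrite mul1n -[RHS](sum_ltn (leq_div (nth 0 s 0) d.+1)).
by apply: eq_big_nat => i _; rewrite leq_divRL.
Qed.
#[local] Hint Resolve Rec_div : rec.

(** * Lists coded by natural numbers *)

Definition cnth c i := nth 0 (CodeSeq.decode c) i.
Definition csize c := size (CodeSeq.decode c).
Definition ccons x c := CodeSeq.code (x :: CodeSeq.decode c).
Definition ctail c := CodeSeq.code (behead (CodeSeq.decode c)).

Lemma cnth_code s i : cnth (CodeSeq.code s) i = nth 0 s i.
Proof. by rewrite /cnth CodeSeq.codeK. Qed.

Lemma csize_code s : csize (CodeSeq.code s) = size s.
Proof. by rewrite /csize CodeSeq.codeK. Qed.

Lemma ccons_code x s : ccons x (CodeSeq.code s) = CodeSeq.code (x :: s).
Proof. by rewrite /ccons CodeSeq.codeK. Qed.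

Lemma ctail_code s : ctail (CodeSeq.code s) = CodeSeq.code (behead s).
Proof. by rewrite /ctail CodeSeq.codeK. Qed.

Lemma csize_gt0 c : (0 < csize c) = (0 < c).
Proof.
rewrite -(CodeSeq.decodeK c) csize_code.
by case: CodeSeq.decode => //= *; rewrite muln_gt0 expn_gt0.
Qed.

Lemma csize_le c : csize c <= c.
Proof.
rewrite -{2}(CodeSeq.decodeK c) /csize; elim: (CodeSeq.decode c) => //= x s IHs.
apply: leq_trans (leq_pmull _ (expn_gt0 2 x)).
by rewrite ltnS -addnn (leq_trans IHs)// leq_addr.
Qed.

(** The 2-adic valuation of [c]: the code of [x :: s] is 2^x times the odd number 2 *
    [CodeSeq.code s] + 1. For [c = 0], the empty list, the count is 0. *)
Definition chead c := \sum_(0 <= i < c) (c %/ 2 ^ i.+1 * 2 ^ i.+1 == c).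

Lemma cheadE c : chead c = cnth c 0.
Proof.
rewrite -(CodeSeq.decodeK c) cnth_code; case: (CodeSeq.decode c) => [|n s].
  by rewrite /chead big_geq.
rewrite /chead; set c' := CodeSeq.code _.
have c'E : c' = 2 ^ n * (CodeSeq.code s).*2.+1 by [].
have nc' : n <= c' by rewrite c'E (leq_trans (ltnW (ltn_expl n (ltnSn 1))))// leq_pmulr.
rewrite -[RHS](sum_ltn nc'); apply: eq_big_nat => i _.
congr (nat_of_bool _); rewrite -dvdn_eq c'E; have [ni|] := ltnP i n.
  by rewrite dvdn_mulr// dvdn_exp2l.
move=> ni; apply/negP => /(dvdn_trans (dvdn_exp2l 2 (ni : n.+1 <= i.+1))).
by rewrite expnSr dvdn_pmul2l ?expn_gt0// dvdn2/= odd_double.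
Qed.

Lemma ctailE c : ctail c = c %/ 2 ^ chead c %/ 2.
Proof.
rewrite cheadE -(CodeSeq.decodeK c) cnth_code ctail_code.
case: (CodeSeq.decode c) => [|n s] /=; first by rewrite div0n.
by rewrite mulKn ?expn_gt0// divn2/= uphalf_double.
Qed.

Lemma Rec_chead a : Rec a -> Rec (fun s => chead (a s)).
Proof. by apply: Rec_subst1; rewrite /chead; rec. Qed.
#[local] Hint Resolve Rec_chead : rec.

Lemma Rec_ctail a : Rec a -> Rec (fun s => ctail (a s)).
Proof.
apply: (@Rec_subst1 ctail).
by apply: (@eq_Rec (fun s => nth 0 s 0 %/ 2 ^ chead (nth 0 s 0) %/ 2)) => [s|];
  [rewrite ctailE | rec].
Qed.
#[local] Hint Resolve Rec_ctail Rec_iter : rec.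

Lemma iter_ctail i c : iter i ctail c = CodeSeq.code (drop i (CodeSeq.decode c)).
Proof.
elim: i => [|i IHi] /=; first by rewrite drop0 CodeSeq.decodeK.
by rewrite IHi ctail_code -drop1 drop_drop.
Qed.

Lemma Rec_cnth a b : Rec a -> Rec b -> Rec (fun s => cnth (a s) (b s)).
Proof.
apply: (@Rec_subst2 cnth).
apply: (@eq_Rec (fun s => chead (iter (nth 0 s 1) ctail (nth 0 s 0)))) => [s|].
  by rewrite cheadE iter_ctail cnth_code nth_drop addn0.
apply: Rec_chead; apply: (Rec_iter (G := fun z _ => ctail z)); rec.
Qed.

Lemma Rec_csize a : Rec a -> Rec (fun s => csize (a s)).
Proof.
apply: (@Rec_subst1 csize).
(* The length is the number of nonzero iterated tails, and by [csize_le] the code itself bounds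
   it. *)
apply: (@eq_Rec (fun s => \sum_(0 <= i < nth 0 s 0) (0 < iter i ctail (nth 0 s 0)))) => [s|].
  rewrite -[RHS](sum_ltn (csize_le (nth 0 s 0))); apply: eq_big_nat => i _.
  by rewrite iter_ctail -csize_gt0 csize_code size_drop subn_gt0.
apply: (Rec_sum (F := fun i s => (0 < iter i ctail (nth 0 s 0))%N : nat)); first by rec.
by apply: Rec_leq; [rec|]; apply: (Rec_iter (G := fun z _ => ctail z)); rec.
Qed.

Lemma Rec_ccons a b : Rec a -> Rec b -> Rec (fun s => ccons (a s) (b s)).
Proof.
apply: (@Rec_subst2 ccons).
apply: (@eq_Rec (fun s => 2 ^ nth 0 s 0 * (2 * nth 0 s 1).+1)) => [s|]; last by rec.
by rewrite mul2n /ccons/= CodeSeq.decodeK.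
Qed.
#[local] Hint Resolve Rec_cnth Rec_csize Rec_ccons : rec.

#[local] Arguments CodeSeq.code : simpl never.

(** * A universal enumeration of the recursive functions *)

(* A derivation [w] codes a list of facts [:: e; x; y; z], read "the program [e]
   maps the argument list coded by [x] to [y]"; [z] lists intermediate values. *)
Definition shows w e x y : bool :=
  has_lt (csize w) (fun i => [&& cnth (cnth w i) 0 == e, cnth (cnth w i) 1 == x
                            & cnth (cnth w i) 2 == y]).

(** The tag [cnth e 0] selects the schema, in the order of the constructors of [recursive]. For
    composition [z] lists the inner values, for primitive recursion it is the preceding value, and
    for minimization it lists the predecessors of the values below [y], which are thereby forced to
    be nonzero. *)
Definition justified w e x y z : bool :=
  if cnth e 0 == 0 then y == 0
  else if cnth e 0 == 1 then y == (cnth x 0).+1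
  else if cnth e 0 == 2 then y == cnth x (cnth e 1)
  else if cnth e 0 == 3 then
    [&& csize z == csize (cnth e 2), shows w (cnth e 1) z y
      & all_lt (csize z) (fun i => shows w (cnth (cnth e 2) i) x (cnth z i))]
  else if cnth e 0 == 4 then
    if cnth x 0 == 0 then shows w (cnth e 1) (ctail x) y
    else shows w e (ccons (cnth x 0).-1 (ctail x)) z &&
         shows w (cnth e 2) (ccons (cnth x 0).-1 (ccons z (ctail x))) y
  else shows w (cnth e 1) (ccons y x) 0 &&
       all_lt y (fun i => shows w (cnth e 1) (ccons i x) (cnth z i).+1).

Definition valid w : bool := all_lt (csize w) (fun i =>
  justified w (cnth (cnth w i) 0) (cnth (cnth w i) 1) (cnth (cnth w i) 2)
    (cnth (cnth w i) 3)).

Lemma Rec_shows a b c d : Rec a -> Rec b -> Rec c -> Rec d ->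
  Rec (fun s => shows (a s) (b s) (c s) (d s)).
Proof.
by apply: (Rec_subst4 (f := fun w e x y => nat_of_bool (shows w e x y)));
  rewrite /shows; rec.
Qed.
#[local] Hint Resolve Rec_shows : rec.

Lemma Rec_valid a : Rec a -> Rec (fun s => valid (a s)).
Proof.
by apply: (Rec_subst1 (f := fun w => nat_of_bool (valid w)));
  rewrite /valid /justified; rec.
Qed.
#[local] Hint Resolve Rec_valid : rec.

Lemma showsP w e x y : reflect
  (exists2 i, i < csize w & [/\ cnth (cnth w i) 0 = e, cnth (cnth w i) 1 = x
                            & cnth (cnth w i) 2 = y]) (shows w e x y).
Proof.
apply: (iffP (has_ltP _ _)) => -[i iw].
  by move=> /and3P[/eqP ? /eqP ? /eqP ?]; exists i.
by move=> [<- <- <-]; exists i => //; rewrite !eqxx.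
Qed.

(** Facts of the derivation occur only positively in a justification. *)
Lemma sub_justified w w' e x y z :
  (forall e x y, shows w e x y -> shows w' e x y) ->
  justified w e x y z -> justified w' e x y z.
Proof.
move=> ww'; rewrite /justified; do 3 case: ifP => // _.
case: ifP => _.
  move=> /and3P[-> /ww' -> /all_ltP H]; apply/all_ltP => i /H.
  exact: ww'.
case: ifP => _; first by case: ifP => _; [exact: ww'|move=> /andP[/ww' -> /ww' ->]].
by move=> /andP[/ww' -> /all_ltP H]; apply/all_ltP => i /H; exact: ww'.
Qed.

(** * Building derivations by concatenation *)

Definition ccat w1 w2 := CodeSeq.code (CodeSeq.decode w1 ++ CodeSeq.decode w2).

Lemma cnth_ccat w1 w2 i : cnth (ccat w1 w2) i =
  if i < csize w1 then cnth w1 i else cnth w2 (i - csize w1).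
Proof. by rewrite cnth_code nth_cat. Qed.

Lemma shows_ccat w1 w2 e x y :
  shows (ccat w1 w2) e x y = shows w1 e x y || shows w2 e x y.
Proof.
have E w : shows w e x y = has (fun f => [&& cnth f 0 == e, cnth f 1 == x
    & cnth f 2 == y]) (CodeSeq.decode w).
  rewrite -[in RHS](mkseq_nth 0 (CodeSeq.decode w)) has_map; exact: eq_has.
by rewrite !E -has_cat CodeSeq.codeK.
Qed.

Lemma valid_ccat w1 w2 : valid w1 -> valid w2 -> valid (ccat w1 w2).
Proof.
move=> /all_ltP V1 /all_ltP V2; apply/all_ltP => i.
rewrite csize_code size_cat cnth_ccat -/(csize w1) -/(csize w2).
case: (ltnP i (csize w1)) => [iw1|w1i] iw.
  by have := V1 i iw1; apply: sub_justified => e x y H; rewrite shows_ccat H.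
have iw2 : i - csize w1 < csize w2 by rewrite ltn_subLR.
by have := V2 _ iw2; apply: sub_justified => e x y H; rewrite shows_ccat H orbT.
Qed.

Definition derivable e x y : Prop := exists2 w, valid w & shows w e x y.

Lemma derivable_common (l : seq (nat * nat * nat)) :
  (forall p, p \in l -> derivable p.1.1 p.1.2 p.2) ->
  exists2 w, valid w & forall p, p \in l -> shows w p.1.1 p.1.2 p.2.
Proof.
elim: l => [|q l IHl] H; first by exists 0.
have [w1 V1 S1] : derivable q.1.1 q.1.2 q.2 by apply: H; rewrite mem_head.
have [p pl|w2 V2 S2] := IHl; first by apply: H; rewrite inE pl orbT.
exists (ccat w1 w2); first exact: valid_ccat.
by move=> p; rewrite inE shows_ccat => /predU1P[->|/S2 ->]; rewrite ?S1 ?orbT.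
Qed.

(** The list [l] holds the premises: the new fact is put in front of a common derivation of them,
    and the old entries stay justified because the derivation only grows. *)
Lemma derivable_step (l : seq (nat * nat * nat)) e x y z :
  (forall p, p \in l -> derivable p.1.1 p.1.2 p.2) ->
  (forall w, (forall p, p \in l -> shows w p.1.1 p.1.2 p.2) ->
     justified w e x y z) ->
  derivable e x y.
Proof.
move=> /derivable_common[w V S] J; pose w0 := CodeSeq.code [:: CodeSeq.code [:: e; x; y; z]].
have S0 : shows w0 e x y.
  by apply/showsP; exists 0; rewrite /w0 ?csize_code// !cnth_code.
exists (ccat w0 w); last by rewrite shows_ccat S0.
move/all_ltP: V => V; apply/all_ltP => i.
rewrite csize_code size_cat cnth_ccat csize_code CodeSeq.codeK.
case: i => [_|i iw] /=.
  by rewrite !cnth_code /=; apply: J => p /S; rewrite shows_ccat => ->; rewrite orbT.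
apply: sub_justified; last by rewrite /= subSS subn0; exact: V.
by move=> *; rewrite shows_ccat; apply/orP; right.
Qed.

(* For soundness no well-foundedness of [w] is needed: programs are compared
   with [h] by induction on the scheme generating [h]. *)
Definition implements e k (h : k.-tuple nat -> nat) : Prop :=
  (forall v : k.-tuple nat, derivable e (CodeSeq.code v) (h v)) /\
  (forall w (v : k.-tuple nat) y, valid w -> shows w e (CodeSeq.code v) y -> y = h v).

Lemma valid_shows w e x y : valid w -> shows w e x y ->
  exists z, justified w e x y z.
Proof.
by move=> /all_ltP V /showsP[i /V J [<- <- <-]]; exists (cnth (cnth w i) 3).
Qed.

Lemma implements_zero k (h : k.-tuple nat -> nat) : (forall v, h v = 0) ->
  implements (CodeSeq.code [::]) h.
Proof.
move=> h0; split=> [v|w v y V /(valid_shows V)[z]]; last by rewrite h0 => /eqP.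
by apply: (derivable_step (l := [::]) (z := 0)) => // w _; rewrite h0.
Qed.

Lemma implements_succ (h : 1.-tuple nat -> nat) : (forall x, h [tuple x] = x.+1) ->
  implements (CodeSeq.code [:: 1]) h.
Proof.
move=> hS; have {}hS (v : 1.-tuple nat) : h v = (nth 0 v 0).+1.
  by case/tupleP: v => a v; rewrite (tuple0 v) -[RHS]/a.+1; exact: hS.
split=> [v|w v y V /(valid_shows V)[z]].
  apply: (derivable_step (l := [::]) (z := 0)) => // w _.
  by rewrite hS /justified !cnth_code /= eqxx.
by rewrite /justified !cnth_code /= hS => /eqP.
Qed.

Lemma implements_proj k (i : 'I_k) (h : k.-tuple nat -> nat) :
  (forall v, h v = tnth v i) -> implements (CodeSeq.code [:: 2; val i]) h.
Proof.
move=> hi; split=> [v|w v y V /(valid_shows V)[z]].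
  apply: (derivable_step (l := [::]) (z := 0)) => // w _.
  by rewrite hi /justified !cnth_code /= (tnth_nth 0).
by rewrite /justified !cnth_code /= hi (tnth_nth 0) => /eqP.
Qed.

Lemma implements_comp k m (f : k.-tuple nat -> nat) (g : 'I_k -> m.-tuple nat -> nat)
    (h : m.-tuple nat -> nat) ef (eg : k.-tuple nat) :
  implements ef f -> (forall i, implements (tnth eg i) (g i)) ->
  (forall v, h v = f [tuple g i v | i < k]) ->
  implements (CodeSeq.code [:: 3; ef; CodeSeq.code eg]) h.
Proof.
move=> [Cf Sf] Ig hE; split=> [v|w v y V /(valid_shows V)[z]].
  have uE i : tnth [tuple g i v | i < k] i = g i v by rewrite tnth_mktuple.
  move: (hE v) uE; move: [tuple _ | _ < _] => u {}hE uE.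
  apply: (derivable_step (z := CodeSeq.code u)
    (l := (ef, CodeSeq.code u, h v) ::
          [seq (tnth eg i, CodeSeq.code v, g i v) | i <- enum 'I_k])).
    move=> p; rewrite inE => /predU1P[->|/mapP[i _ ->]].
      by rewrite hE; exact: Cf.
    exact: (Ig i).1.
  move=> w S; rewrite /justified !cnth_code /= !csize_code !size_tuple eqxx /=.
  rewrite (S (_, _, _) (mem_head _ _)) /=; apply/all_ltP => i ik.
  rewrite !cnth_code; have := S (tnth eg (Ordinal ik), CodeSeq.code v, g (Ordinal ik) v).
  rewrite inE map_f ?mem_enum ?orbT// => /(_ isT).
  by rewrite -uE !(tnth_nth 0).
rewrite /justified !cnth_code /= csize_code size_tuple.
move=> /and3P[/eqP zk Sfz /all_ltP Sg].
(* Soundness of the inner programs leaves only one possible list of intermediate values. *)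
suff zE : z = CodeSeq.code [tuple g i v | i < k].
  by rewrite hE; apply: (Sf w) => //; rewrite -zE.
rewrite -[LHS]CodeSeq.decodeK; congr CodeSeq.code.
apply: (@eq_from_nth _ 0) => [|i]; rewrite -/(csize z) zk ?size_tuple// => ik.
rewrite -[in RHS]/(nat_of_ord (Ordinal ik)) -tnth_nth tnth_mktuple.
apply: (Ig (Ordinal ik)).2 V _; rewrite (tnth_nth 0) -cnth_code; apply: Sg.
by rewrite zk.
Qed.

Lemma implements_prim k (f : k.-tuple nat -> nat) (g : k.+2.-tuple nat -> nat)
    (h : k.+1.-tuple nat -> nat) ef eg :
  implements ef f -> implements eg g ->
  (forall v : k.-tuple nat, h [tuple of 0 :: v] = f v) ->
  (forall x (v : k.-tuple nat), h [tuple of x.+1 :: v] =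
                 g [tuple of x :: h [tuple of x :: v] :: v]) ->
  implements (CodeSeq.code [:: 4; ef; eg]) h.
Proof.
move=> [Cf Sf] [Cg Sg] h0 hS; split=> [v|w v y V];
    case/tupleP: v => x v.
  elim: x => [|x IHx].
    apply: (derivable_step (l := [:: (ef, CodeSeq.code v, f v)]) (z := 0)).
      by move=> p; rewrite inE => /eqP->; exact: Cf.
    move=> w S; rewrite /justified !cnth_code /= ctail_code /= h0.
    exact: (S (_, _, _) (mem_head _ _)).
  pose r := h [tuple of x :: v].
  apply: (derivable_step (z := r)
    (l := [:: (CodeSeq.code [:: 4; ef; eg], CodeSeq.code (x :: v), r);
              (eg, CodeSeq.code [:: x, r & v], g [tuple of x :: r :: v])])).
    move=> p; rewrite !inE => /orP[]/eqP-> /=; first exact: IHx.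
    exact: (Cg [tuple of x :: r :: v]).
  move=> w S; rewrite /justified !cnth_code /= !ctail_code /= !ccons_code hS -/r.
  rewrite (S (_, _, _) (mem_head _ _)) /=.
  by apply: (S (_, _, _)); rewrite !inE eqxx orbT.
elim: x y => [|x IHx] y /(valid_shows V)[z].
  by rewrite /justified !cnth_code /= ctail_code /= h0; exact: Sf.
rewrite /justified !cnth_code /= !ctail_code /= !ccons_code => /andP[/IHx -> H].
by rewrite hS; apply: Sg V _.
Qed.

Lemma implements_min k (f : k.+1.-tuple nat -> nat) (h : k.-tuple nat -> nat) ef :
  implements ef f ->
  (forall v : k.-tuple nat, f [tuple of h v :: v] = 0) ->
  (forall (v : k.-tuple nat) y, y < h v -> f [tuple of y :: v] <> 0) ->
  implements (CodeSeq.code [:: 5; ef]) h.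
Proof.
move=> [Cf Sf] h0 hN; split=> [v|w v y V /(valid_shows V)[z]].
  apply: (derivable_step
    (z := CodeSeq.code (mkseq (fun i => (f [tuple of i :: v]).-1) (h v)))
    (l := (ef, CodeSeq.code (h v :: v), 0) ::
       mkseq (fun i => (ef, CodeSeq.code (i :: v), f [tuple of i :: v])) (h v))).
    move=> p; rewrite inE => /predU1P[->|/mapP[i _ ->]] /=; last exact: (Cf [tuple of i :: v]).
    by rewrite -(h0 v); exact: (Cf [tuple of h v :: v]).
  move=> w S; rewrite /justified !cnth_code /= ccons_code.
  rewrite (S (_, _, _) (mem_head _ _)) /=; apply/all_ltP => i ih.
  rewrite ccons_code cnth_code nth_mkseq// prednK ?lt0n; last exact/eqP/hN.
  by apply: (S (_, _, _)); rewrite inE map_f ?orbT// mem_iota.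
rewrite /justified !cnth_code /= ccons_code.
move=> /andP[/(Sf w [tuple of y :: v] _ V) fy /all_ltP H].
(* A smaller [y] would be a zero of [f] before the first one; for a larger [y] the derivation
   records a nonzero value at [h v]. *)
case: (ltngtP y (h v)) => // [/hN|/H]; first by rewrite -fy.
by rewrite ccons_code => /(Sf w [tuple of h v :: v] _ V); rewrite h0.
Qed.

Theorem recursive_implements k (h : k.-tuple nat -> nat) : recursive h ->
  exists e, implements e h.
Proof.
elim=> {k h}.
- by move=> k h /implements_zero; exists (CodeSeq.code [::]).
- by move=> h /implements_succ; exists (CodeSeq.code [:: 1]).
- by move=> k i h /implements_proj; exists (CodeSeq.code [:: 2; val i]).
- move=> k m f g h _ [ef If] _ /choice[eg Ig] hE.
  exists (CodeSeq.code [:: 3; ef; CodeSeq.code [tuple eg i | i < k]]).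
  by apply: implements_comp If _ hE => i; rewrite tnth_mktuple.
- move=> k f g h _ [ef If] _ [eg Ig] h0 hS.
  by exists (CodeSeq.code [:: 4; ef; eg]); exact: implements_prim If Ig h0 hS.
- move=> k f h _ [ef If] h0 hN.
  by exists (CodeSeq.code [:: 5; ef]); exact: implements_min If h0 hN.
Qed.

(** * Finite stages of the optimal outer measure *)

(** Equality of two fractions, cross-multiplied and with the subtracted terms moved across, so that
    it stays within the natural numbers. *)
Definition same_rat c d : bool :=
  cnth c 0 * (cnth d 2).+1 + cnth d 1 * (cnth c 2).+1 ==
  cnth d 0 * (cnth c 2).+1 + cnth c 1 * (cnth d 2).+1.

Definition same_vec n c d : bool :=
  all_lt n (fun i => same_rat (cnth c i) (cnth d i)).

Definition mem_code n d a : bool :=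
  has_lt (csize a) (fun i => same_vec n d (cnth a i)).

Definition bit i m : bool := m %/ 2 ^ i %/ 2 * 2 != m %/ 2 ^ i.

(* The points with codes below [t] are represented by the bits of masks
   [m < 2 ^ t], and families of sets of such points by the bits of numbers
   [c < 2 ^ 2 ^ t]. *)
Definition sub_mask n t m a : bool :=
  all_lt (csize a) (fun i => has_lt t (fun d => bit d m && same_vec n d (cnth a i))).

(** The floor of 2^t q / 2^k for the rational q coded by [y]; truncated subtraction gives 0 for
    negative q. *)
Definition scaled t k y : nat :=
  (2 ^ t * (cnth y 0 - cnth y 1)) %/ ((cnth y 2).+1 * 2 ^ k).

(* The index [e] codes a program [cnth e 0] and a scaling exponent [cnth e 1];
   all values of stage [t] are in units of [2 ^- t]. *)
Definition mask_approx n e t m : nat :=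
  \max_(0 <= w < t) \max_(0 <= j < csize w)
    if [&& valid w, cnth (cnth w j) 0 == cnth e 0, csize (cnth (cnth w j) 1) == 2,
           0 < cnth (cnth (cnth w j) 1) 0
         & sub_mask n t m (cnth (cnth (cnth w j) 1) 0)]
    then scaled t (cnth e 1) (cnth (cnth w j) 2) else 0.

Definition covers t (D : pred nat) c : bool :=
  all_lt t (fun d => D d ==> has_lt (2 ^ t) (fun m => bit m c && bit d m)).

Definition cost n e t c : nat := \sum_(0 <= m < 2 ^ t) bit m c * mask_approx n e t m.

(** The cost of the family of all masks, which covers every set; it is the default value of the
    minimum below. *)
Definition total_cost n e t : nat := \sum_(0 <= m < 2 ^ t) mask_approx n e t m.

(* The largest outer measure below [mask_approx]. *)
Definition cover_min n e t (D : pred nat) : nat :=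
  bmin (2 ^ 2 ^ t) (total_cost n e t)
    (fun c => if covers t D c then cost n e t c else total_cost n e t).

(** Selects one code per rational point, so that sums over codes count every point mass once. *)
Definition least_code n d : bool := all_lt d (fun d' => ~~ same_vec n d' d).

(** [ccons d 0] codes a singleton, and 2^s is mass 1 in units of 2^-s. Points without a code below
    [s] have no mass at stage [s], so the finite sum is the total point mass. *)
Definition good n e s : bool :=
  \sum_(0 <= d < s) least_code n d *
     cover_min n e s (fun d' => mem_code n d' (ccons d 0)) <= 2 ^ s.

(* The approximation is frozen as soon as its total mass would exceed 1. *)
Definition frozen n e t (D : pred nat) : nat :=
  \max_(0 <= s < t.+1) (good n e s * (cover_min n e s D * 2 ^ (t - s))).

(** The unit is now 2^-2t, which makes the weight 2^-e of index [e] an integer multiple of 2^-t. *)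
Definition stage n t (D : pred nat) : nat :=
  \sum_(0 <= e < t) 2 ^ (t - e) * frozen n e t D.

(** * Recursiveness of the stages *)

Lemma Rec_same_vec n a b : Rec a -> Rec b ->
  Rec (fun s => same_vec n (a s) (b s)).
Proof.
by apply: (Rec_subst2 (f := fun x y => nat_of_bool (same_vec n x y)));
  rewrite /same_vec /same_rat; rec.
Qed.
#[local] Hint Resolve Rec_same_vec : rec.

Lemma Rec_mem_code n a b : Rec a -> Rec b ->
  Rec (fun s => mem_code n (a s) (b s)).
Proof.
by apply: (Rec_subst2 (f := fun x y => nat_of_bool (mem_code n x y)));
  rewrite /mem_code; rec.
Qed.
#[local] Hint Resolve Rec_mem_code : rec.

Lemma Rec_bit a b : Rec a -> Rec b -> Rec (fun s => bit (a s) (b s)).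
Proof.
by apply: (Rec_subst2 (f := fun x y => nat_of_bool (bit x y))); rewrite /bit; rec.
Qed.
#[local] Hint Resolve Rec_bit : rec.

Lemma Rec_sub_mask n a b c : Rec a -> Rec b -> Rec c ->
  Rec (fun s => sub_mask n (a s) (b s) (c s)).
Proof.
by apply: (Rec_subst3 (f := fun x y z => nat_of_bool (sub_mask n x y z)));
  rewrite /sub_mask; rec.
Qed.
#[local] Hint Resolve Rec_sub_mask : rec.

Lemma Rec_scaled a b c : Rec a -> Rec b -> Rec c ->
  Rec (fun s => scaled (a s) (b s) (c s)).
Proof. by apply: Rec_subst3; rewrite /scaled; rec. Qed.
#[local] Hint Resolve Rec_scaled : rec.

Lemma Rec_mask_approx n a b c : Rec a -> Rec b -> Rec c ->
  Rec (fun s => mask_approx n (a s) (b s) (c s)).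
Proof. by apply: Rec_subst3; rewrite /mask_approx; rec. Qed.
#[local] Hint Resolve Rec_mask_approx : rec.

Lemma Rec_cost n a b c : Rec a -> Rec b -> Rec c ->
  Rec (fun s => cost n (a s) (b s) (c s)).
Proof. by apply: Rec_subst3; rewrite /cost; rec. Qed.
#[local] Hint Resolve Rec_cost : rec.

Lemma Rec_total_cost n a b : Rec a -> Rec b -> Rec (fun s => total_cost n (a s) (b s)).
Proof. by apply: Rec_subst2; rewrite /total_cost; rec. Qed.
#[local] Hint Resolve Rec_total_cost : rec.

Lemma Rec_cover_min n a b c : Rec a -> Rec b -> Rec c ->
  Rec (fun s => cover_min n (a s) (b s) (fun d => mem_code n d (c s))).
Proof.
apply: (Rec_subst3 (f := fun e t a => cover_min n e t (fun d => mem_code n d a))).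
by rewrite /cover_min /covers; rec.
Qed.
#[local] Hint Resolve Rec_cover_min : rec.

Lemma Rec_good n a b : Rec a -> Rec b -> Rec (fun s => good n (a s) (b s)).
Proof.
by apply: (Rec_subst2 (f := fun e t => nat_of_bool (good n e t)));
  rewrite /good /least_code; rec.
Qed.
#[local] Hint Resolve Rec_good : rec.

Lemma Rec_stage n a b : Rec a -> Rec b ->
  Rec (fun s => stage n (a s) (fun d => mem_code n d (b s))).
Proof.
apply: (Rec_subst2 (f := fun t a => stage n t (fun d => mem_code n d a))).
by rewrite /stage /frozen; rec.
Qed.

(** * Minimal covers by families of masks *)

Lemma bmin_le m z F i : i < m -> bmin m z F <= F i.
Proof.
elim: m => // m IHm; rewrite ltnS leq_eqVlt => /predU1P[->|/IHm im] /=.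
  exact: geq_minr.
exact: leq_trans (geq_minl _ _) im.
Qed.

Lemma bmin_ex m z F : bmin m z F = z \/ exists2 i, i < m & bmin m z F = F i.
Proof.
elim: m => [|m IHm] /=; first by left.
rewrite /bmin /= -/(bmin m z F) /minn; case: ifP => _; last by right; exists m.
by case: IHm => [->|[i im ->]]; [left|right; exists i => //; exact: ltnW].
Qed.

Lemma bitE i m : bit i m = odd (m %/ 2 ^ i).
Proof.
rewrite /bit; set x := m %/ 2 ^ i.
rewrite -{2}(odd_double_half x) divn2 muln2; case: (odd x).
  by rewrite add1n neq_ltn ltnSn.
by rewrite eqxx.
Qed.

Lemma bit_addexp t d m : d < t -> bit d (m + 2 ^ t) = bit d m.
Proof.
move=> dt; rewrite !bitE -(subnK (ltnW dt)) expnD addnC divnMDl ?expn_gt0//.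
by rewrite oddD oddX subn_eq0 leqNgt dt.
Qed.

Lemma ex_bits k (b : pred nat) : exists2 c, c < 2 ^ k & forall i, i < k -> bit i c = b i.
Proof.
elim: k b => [|k IHk] b; first by exists 0.
have [c ck cb] := IHk (b \o S); exists (b 0 + c.*2).
  rewrite expnS mul2n; apply: (@leq_trans c.+1.*2); last by rewrite leq_double.
  by rewrite doubleS; case: (b 0); rewrite ?ltnS ?leqnn ?leqnSn.
case=> [_|i ik]; rewrite bitE; first by rewrite divn1 oddD odd_double addbF oddb.
by rewrite -[RHS](cb i)// bitE expnS divnMA divn2 half_bit_double.
Qed.

Lemma mem_code1 n d d' : mem_code n d' (ccons d 0) = same_vec n d' d.
Proof.
by rewrite /mem_code /has_lt (ccons_code d [::]) csize_code /= cnth_code orbF.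
Qed.

(** A family is a predicate on masks here rather than a number coding it; [cover_min_le] and
    [cover_min_ex] keep the codes out of the later arguments. *)
Definition family_covers t (D B : pred nat) : Prop :=
  forall d, d < t -> D d -> exists2 m, m < 2 ^ t & B m && bit d m.

Lemma coversP t D c : reflect (family_covers t D (bit^~ c)) (covers t D c).
Proof.
apply: (iffP (all_ltP _ _)) => H d dt.
  by move=> Dd; have /implyP/(_ Dd)/has_ltP[m mt] := H d dt; exists m.
by apply/implyP => Dd; apply/has_ltP; apply: H.
Qed.

Lemma cover_min_le n e t D B : family_covers t D B ->
  cover_min n e t D <= \sum_(0 <= m < 2 ^ t) B m * mask_approx n e t m.
Proof.
have [c ct cB] := ex_bits (2 ^ t) B => DB.
apply: (leq_trans (bmin_le _ _ ct)); rewrite ifT.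
  rewrite /cost big_nat [leqRHS]big_nat; apply: leq_sum => m /andP[_ mt].
  by rewrite cB.
by apply/coversP => d dt /(DB d dt)[m mt H]; exists m => //=; rewrite cB.
Qed.

Lemma cover_min_ex n e t D : exists2 B, family_covers t D B &
  cover_min n e t D = \sum_(0 <= m < 2 ^ t) B m * mask_approx n e t m.
Proof.
have TE : exists2 B, family_covers t D B &
    total_cost n e t = \sum_(0 <= m < 2 ^ t) B m * mask_approx n e t m.
  exists xpredT; last by apply: eq_bigr => m _; rewrite mul1n.
  have [m mt mb] := ex_bits t xpredT.
  by move=> d dt _; exists m => //=; rewrite mb.
rewrite /cover_min; set F := (F in bmin _ _ F).
have [->|[c ct ->]] := bmin_ex (2 ^ 2 ^ t) (total_cost n e t) F => //.
by rewrite /F; case: coversP => // Dc; exists (bit^~ c).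
Qed.

Lemma cover_min0 n e t (D : pred nat) : (forall d, d < t -> ~~ D d) ->
  cover_min n e t D = 0.
Proof.
move=> D0; apply/eqP; rewrite -leqn0; apply: (leq_trans (@cover_min_le _ _ _ _ pred0 _)).
  by move=> d /D0/negP.
by rewrite big1.
Qed.

Lemma cover_min_subset n e t (D D' : pred nat) : (forall d, d < t -> D d -> D' d) ->
  cover_min n e t D <= cover_min n e t D'.
Proof.
move=> DD'; have [B D'B ->] := cover_min_ex n e t D'.
by apply: cover_min_le => d dt Dd; apply: D'B => //; exact: DD'.
Qed.

Lemma cover_minU n e t (D D' : pred nat) : cover_min n e t (predU D D') <=
  cover_min n e t D + cover_min n e t D'.
Proof.
have [B DB ->] := cover_min_ex n e t D; have [B' DB' ->] := cover_min_ex n e t D'.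
rewrite -big_split/=; apply: (@leq_trans (\sum_(0 <= m < 2 ^ t)
    (predU B B') m * mask_approx n e t m)).
  apply: cover_min_le => d dt /orP[/(DB d dt)|/(DB' d dt)] [m mt /andP[Bm dm]];
    by exists m => //; rewrite /= Bm dm ?orbT.
apply: leq_sum => m _; rewrite -mulnDl leq_mul2r /=; apply/orP; right.
by case: (B m); case: (B' m).
Qed.

Lemma leq_scaled t k y : 2 * scaled t k y <= scaled t.+1 k y.
Proof.
rewrite /scaled leq_divRL ?muln_gt0 ?expn_gt0//.
by rewrite expnS -!mulnA leq_mul2l/= leq_divM.
Qed.

Lemma sub_mask_mono n t t' m m' a : t <= t' ->
  (forall d, d < t -> bit d m -> bit d m') -> sub_mask n t m a -> sub_mask n t' m' a.
Proof.
move=> tt' mm' /all_ltP H; apply/all_ltP => i /H /has_ltP[d dt /andP[dm Hd]].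
by apply/has_ltP; exists d; rewrite ?(leq_trans dt)// mm'.
Qed.

(** The factor 2 is the change of unit from 2^-t to 2^-(t+1): derivations below [t] remain
    available, a larger mask contains more coded sets, and rounding on a finer grid loses no
    more. *)
Lemma leq_mask_approx n e t m m' : (forall d, d < t -> bit d m -> bit d m') ->
  2 * mask_approx n e t m <= mask_approx n e t.+1 m'.
Proof.
move=> mm'; rewrite {2}/mask_approx big_nat_recr//=; apply: leq_trans (leq_maxl _ _).
rewrite /mask_approx; elim/big_rec2: _ => // w x y _ IH.
rewrite maxnMr; set y1 := \big[_/_]_(_ <= _ < _) _; set x1 := \big[_/_]_(_ <= _ < _) _.
suff xy : 2 * y1 <= x1.
  by rewrite geq_max (leq_trans xy (leq_maxl _ _)) (leq_trans IH (leq_maxr _ _)).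
rewrite {}/x1 {}/y1; elim/big_rec2: _ => // j x1 y1 _ IHj; rewrite maxnMr geq_max.
rewrite [X in _ && X](leq_trans IHj (leq_maxr _ _)) andbT; apply: leq_trans (leq_maxl _ _).
case: ifP => // /and5P[-> -> -> -> /(sub_mask_mono (leqnSn _) mm') ->] /=.
exact: leq_scaled.
Qed.

Lemma sum_exp2S t F : \sum_(0 <= m < 2 ^ t.+1) F m =
  \sum_(0 <= m < 2 ^ t) F m + \sum_(0 <= m < 2 ^ t) F (m + 2 ^ t).
Proof.
rewrite expnS mul2n -addnn (@big_cat_nat _ _ _ (2 ^ t)) ?leq_addr//=.
by rewrite -{2}(add0n (2 ^ t)) big_addn addnK.
Qed.

(** A cover at stage t+1 becomes one at stage t when the top bit of each mask is dropped. Both masks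
    with a given restriction have at least twice its bound, so the restricted family costs at most
    half. *)
Lemma leq_cover_min n e t D : 2 * cover_min n e t D <= cover_min n e t.+1 D.
Proof.
have [B DB ->] := cover_min_ex n e t.+1 D.
pose B' m := B m || B (m + 2 ^ t).
apply: (@leq_trans (2 * \sum_(0 <= m < 2 ^ t) B' m * mask_approx n e t m)).
  rewrite leq_mul2l/=; apply: cover_min_le => d dt /(DB d (ltnW dt))[m mt /andP[Bm dm]].
  have [mt'|tm] := ltnP m (2 ^ t); first by exists m; rewrite // /B' Bm dm.
  exists (m - 2 ^ t); first by rewrite ltn_subLR// addnn -mul2n -expnS.
  by rewrite /B' subnK// Bm orbT/= -(bit_addexp _ dt) subnK.
rewrite sum_exp2S -big_split big_distrr/=.
apply: leq_sum => m _; rewrite mulnCA /B'.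
have m1 : 2 * mask_approx n e t m <= mask_approx n e t.+1 m by apply: leq_mask_approx.
have m2 : 2 * mask_approx n e t m <= mask_approx n e t.+1 (m + 2 ^ t).
  by apply: leq_mask_approx => d dt; rewrite bit_addexp.
case: (B m); case: (B (m + 2 ^ t)); rewrite ?mul1n ?mul0n ?addn0 ?add0n//.
by rewrite (leq_trans m1)// leq_addr.
Qed.

Lemma leq_cover_min_exp n e s t D : s <= t ->
  cover_min n e s D * 2 ^ (t - s) <= cover_min n e t D.
Proof.
move=> /subnK <-; elim: (t - s) => [|r IHr]; first by rewrite addnK muln1.
rewrite addnK in IHr; rewrite addnK addSn (leq_trans _ (leq_cover_min _ _ _ _))//.
by rewrite expnS mulnCA leq_mul2l.
Qed.

(** * Frozen approximations and their total mass *)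

Lemma frozen0 n e t (D : pred nat) : (forall d, d < t -> ~~ D d) -> frozen n e t D = 0.
Proof.
move=> D0; rewrite /frozen big_nat big1// => s /andP[_ st].
by rewrite cover_min0 ?muln0// => d ds; apply: D0; exact: leq_trans ds st.
Qed.

Lemma frozen_subset n e t (D D' : pred nat) : (forall d, d < t -> D d -> D' d) ->
  frozen n e t D <= frozen n e t D'.
Proof.
move=> DD'; rewrite /frozen !big_nat; elim/big_rec2: _ => // s x y /andP[_ st] IH.
rewrite geq_max (leq_trans IH (leq_maxr _ _)) andbT; apply: leq_trans (leq_maxl _ _).
rewrite !leq_mul// cover_min_subset// => d ds; apply: DD'; exact: leq_trans ds st.
Qed.

Lemma frozenU n e t (D D' : pred nat) :
  frozen n e t (predU D D') <= frozen n e t D + frozen n e t D'.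
Proof.
rewrite /frozen; elim/big_rec3: _ => // s x y z _ IH.
rewrite geq_max; apply/andP; split; last first.
  by rewrite (leq_trans IH)// leq_add// leq_maxr.
apply: (@leq_trans (good n e s * (cover_min n e s D * 2 ^ (t - s)) +
                    good n e s * (cover_min n e s D' * 2 ^ (t - s)))).
  by rewrite -mulnDr -mulnDl !leq_mul// cover_minU.
by rewrite leq_add// leq_maxl.
Qed.

Lemma leq_frozen n e t D : 2 * frozen n e t D <= frozen n e t.+1 D.
Proof.
rewrite {2}/frozen big_nat_recr//=; apply: leq_trans (leq_maxl _ _).
rewrite /frozen !big_nat; elim/big_rec2: _ => // s x y /andP[_ st] IH.
rewrite maxnMr geq_max; apply/andP; split; last exact: leq_trans IH (leq_maxr _ _).
apply: leq_trans (leq_maxl _ _).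
by rewrite subSn// expnS mulnCA (mulnCA 2).
Qed.

Lemma frozen_good n e t D : (forall s, good n e s) -> cover_min n e t D <= frozen n e t D.
Proof.
move=> G; rewrite /frozen big_nat_recr//= subnn muln1 G mul1n; exact: leq_maxr.
Qed.

(** A point whose least code is at least [s] is invisible at stage [s], so codes from [s] on
    contribute nothing. *)
Lemma cover_min_least_code n e s K :
  \sum_(0 <= d < K) least_code n d * cover_min n e s (same_vec n^~ d) <=
  \sum_(0 <= d < s) least_code n d * cover_min n e s (same_vec n^~ d).
Proof.
apply: (@leq_trans (\sum_(0 <= d < s + K) least_code n d * cover_min n e s (same_vec n^~ d))).
  by rewrite (@big_cat_nat _ _ _ K 0 (s + K))//= ?leq_addl// leq_addr.
rewrite (@big_cat_nat _ _ _ s)//= ?leq_addr// [X in _ + X]big1_seq ?addn0// => d.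
rewrite mem_index_iota => /andP[_ /andP[sd _]].
case: (boolP (least_code n d)) => // /all_ltP C.
by rewrite cover_min0// => d' d's; apply: C; exact: leq_trans d's sd.
Qed.

(** The last good stage attains the maximum in [frozen] for all sets at once, because rescaled cover
    values increase with the stage; its mass bound therefore carries over. *)
Lemma frozen_mass n e t K :
  \sum_(0 <= d < K) least_code n d * frozen n e t (same_vec n^~ d) <= 2 ^ t.
Proof.
have [s /andP[st Gs] smax] : exists2 s, (s <= t) && good n e s &
    forall s', s' <= t -> good n e s' -> s' <= s.
  have ex : exists s, (s <= t) && good n e s.
    (* Stage 0 is good because its sum is empty. *)
    by exists 0; rewrite /= /good big_geq.
  have ub s : (s <= t) && good n e s -> s <= t by case/andP.
  case: (ex_maxnP ex ub) => s H smax; exists s => // s' s't Gs'.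
  by apply: smax; rewrite s't.
have frE D : frozen n e t D <= cover_min n e s D * 2 ^ (t - s).
  rewrite /frozen big_nat; elim/big_rec: _ => // s' x /andP[_ s't] IH.
  rewrite geq_max IH andbT; case: (boolP (good n e s')) => // Gs'; rewrite mul1n.
  have s's := smax s' s't Gs'.
  rewrite (_ : t - s' = (s - s') + (t - s)); last by rewrite addnC addnBA// subnK.
  by rewrite expnD mulnA leq_mul// leq_cover_min_exp.
apply: (@leq_trans ((\sum_(0 <= d < K) least_code n d *
    cover_min n e s (same_vec n^~ d)) * 2 ^ (t - s))).
  rewrite big_distrl/=; apply: leq_sum => d _.
  by rewrite -mulnA leq_mul2l frE orbT.
rewrite -{2}(subnKC st) expnD leq_mul// (leq_trans (cover_min_least_code _ _ _ _))//.
apply: leq_trans Gs; apply: leq_sum => d _; rewrite leq_mul2l.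
by rewrite cover_min_subset ?orbT// => d' _; rewrite mem_code1.
Qed.

Lemma stage0 n t (D : pred nat) : (forall d, d < t -> ~~ D d) -> stage n t D = 0.
Proof. by move=> D0; rewrite /stage big1// => e _; rewrite frozen0 ?muln0. Qed.

Lemma stage_subset n t (D D' : pred nat) : (forall d, d < t -> D d -> D' d) ->
  stage n t D <= stage n t D'.
Proof.
by move=> DD'; apply: leq_sum => e _; rewrite leq_mul2l frozen_subset ?orbT.
Qed.

Lemma stageU n t (D D' : pred nat) : stage n t (predU D D') <= stage n t D + stage n t D'.
Proof.
rewrite /stage -big_split; apply: leq_sum => e _ /=.
by rewrite -mulnDr leq_mul2l frozenU orbT.
Qed.

Lemma stage_bigU n t (D : nat -> pred nat) K :
  stage n t (fun d => has_lt K (fun k => D k d)) <= \sum_(0 <= k < K) stage n t (D k).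
Proof.
elim: K => [|K IHK]; first by rewrite stage0// big_geq.
rewrite big_nat_recr//= (leq_trans _ (leq_add IHK (leqnn _)))//.
apply: leq_trans (stageU _ _ _ _); apply: stage_subset => d _ /has_ltP[k].
rewrite ltnS leq_eqVlt => /predU1P[-> DK|kK Dk] /=; first by rewrite DK orbT.
by apply/orP; left; apply/has_ltP; exists k.
Qed.

(** Passing to the next stage divides the unit 2^-2t by 4. *)
Lemma leq_stage n t D : 4 * stage n t D <= stage n t.+1 D.
Proof.
rewrite /stage big_nat_recr//=; apply: leq_trans (leq_addr _ _).
rewrite big_distrr !big_nat; apply: leq_sum => e /andP[_ et] /=.
by rewrite subSn ?(ltnW et)// expnS (mulnACA 2 2) leq_mul// leq_frozen.
Qed.

Lemma sum_exp2 t : \sum_(0 <= e < t) 2 ^ (t - e) <= 2 ^ t.+1.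
Proof.
(* Adding 2 turns the geometric sum into an exact power, which suits the induction. *)
suff : \sum_(0 <= e < t) 2 ^ (t - e) + 2 = 2 ^ t.+1 by move=> <-; exact: leq_addr.
elim: t => [|t IHt]; first by rewrite big_geq.
rewrite big_nat_recl//= -addnA (eq_bigr (fun e => 2 ^ (t - e))) => [|e _].
  by rewrite IHt addnn -mul2n -expnS.
by rewrite subSS.
Qed.

Lemma stage_mass n t K :
  \sum_(0 <= d < K) least_code n d * stage n t (same_vec n^~ d) <= 2 ^ t.*2.+1.
Proof.
under eq_bigr do rewrite /stage big_distrr/=.
rewrite exchange_big/=.
apply: (@leq_trans (\sum_(0 <= e < t) 2 ^ (t - e) * 2 ^ t)).
  apply: leq_sum => e _; under eq_bigr do rewrite mulnCA.
  by rewrite -big_distrr leq_mul// frozen_mass.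
by rewrite -big_distrl/= -addnn -addSn expnD leq_mul// sum_exp2.
Qed.

Lemma stage_good n e t D : (forall s, good n e s) -> e < t ->
  2 ^ (t - e) * cover_min n e t D <= stage n t D.
Proof.
move=> G et; rewrite /stage big_mkord (bigD1 (Ordinal et))//=.
by rewrite (leq_trans _ (leq_addr _ _))// leq_mul// frozen_good.
Qed.

(** * The optimal outer measure *)

Local Open Scope classical_set_scope.
Local Open Scope ring_scope.

(** * Meaning of the tests on codes *)

Lemma same_ratE c d : same_rat c d = (rat_of_code c == rat_of_code d).
Proof.
rewrite /same_rat /rat_of_code -!/(cnth _ _) eqr_div ?pnatr_eq0//.
rewrite -(eqr_nat rat) -[LHS]subr_eq0 -[RHS]subr_eq0 !natrD !natrM.
by congr (_ == 0); ring.
Qed.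

Lemma same_vecE n c d : same_vec n c d = (ratvec_of_code n c == ratvec_of_code n d).
Proof.
apply/all_ltP/eqP => [H|/rowP H i i_n].
  by apply/rowP => i; rewrite !mxE; apply/eqP; rewrite -same_ratE; exact: H.
by rewrite same_ratE; have := H (Ordinal i_n); rewrite !mxE /= => ->.
Qed.

Lemma mem_codeE n d a : mem_code n d a = (ratvec_of_code n d \in ratset_of_code n a).
Proof.
rewrite /mem_code; apply/has_ltP/idP => [[i ia]|].
  rewrite same_vecE => /eqP ->; rewrite !inE; apply: map_f; exact: mem_nth.
rewrite !inE => /mapP[c /(nthP 0%N)[i ia <-] H].
by exists i => //; rewrite same_vecE H.
Qed.

Lemma sub_maskP n t m a : sub_mask n t m a -> forall q, q \in ratset_of_code n a ->
  exists2 d, (d < t)%N & bit d m && (ratvec_of_code n d == q).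
Proof.
move=> /all_ltP H q; rewrite !inE => /mapP[c /(nthP 0%N)[i ia <-] ->].
have /has_ltP[d dt /andP[dm]] := H i ia; rewrite same_vecE => E.
by exists d; rewrite ?dm.
Qed.

Lemma scaled_le t k y : 0 <= rat_of_code y ->
  (scaled t k y * 2 ^ k)%:R <= 2 ^+ t * rat_of_code y.
Proof.
rewrite /rat_of_code -!/(cnth _ _) /scaled; set a := cnth y 0; set b := cnth y 1.
set d := cnth y 2; rewrite pmulr_lge0 ?invr_gt0 ?ltr0n// subr_ge0 ler_nat => ba.
rewrite -natrB// mulrA ler_pdivlMr ?ltr0n// -natrX -!natrM ler_nat.
by rewrite -mulnA (mulnC _ d.+1) leq_divM.
Qed.

(** Truncated subtraction can only enlarge the numerator, so this bound holds for either sign. *)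
Lemma scaled_gt t k y : 2 ^+ t * rat_of_code y < ((scaled t k y).+1 * 2 ^ k)%:R.
Proof.
rewrite /rat_of_code -!/(cnth _ _) /scaled; set a := cnth y 0; set b := cnth y 1.
set d := cnth y 2.
apply: (@le_lt_trans _ _ (2 ^+ t * ((a - b)%N%:R / d.+1%:R))).
  rewrite ler_pM2l ?exprn_gt0// ler_pM2r ?invr_gt0 ?ltr0n//.
  have [ab|ba] := leqP a b; last by rewrite natrB// ltnW.
  by rewrite (eqP ab) subr_le0 ler_nat.
rewrite mulrA ltr_pdivrMr ?ltr0n// -natrX -!natrM ltr_nat.
by rewrite -mulnA (mulnC _ d.+1) ltn_ceil// muln_gt0 expn_gt0.
Qed.

(** * The limit of the stages *)

Section OptimalMeasure.
Variables (R : realType) (n : nat).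

Let point d : 'rV[R]_n := ratpoint R (ratvec_of_code n d).

Let codes (E : set 'rV[R]_n) : pred nat := fun d => `[< E (point d) >].

Lemma ratpoint_inj : injective (@ratpoint R n).
Proof.
move=> x y /rowP H; apply/rowP => i; have := H i; rewrite !mxE.
exact: (fmorph_inj (ratr : {rmorphism rat -> R})).
Qed.

(** Beyond the unit 2^-2t there is a further factor 1/2, since the weights 2^-e add up to at most
    2. *)
Definition approx_measure t E : R := (stage n t (codes E))%:R / 2 ^+ t.*2.+1.

Definition optimal_measure E : \bar R := ereal_sup (range (fun t => (approx_measure t E)%:E)).

Lemma approx_measure_nd E : nondecreasing_seq (approx_measure^~ E).
Proof.
apply/nondecreasing_seqP => t; rewrite /approx_measure.
rewrite doubleS (_ : 2 ^+ t.*2.+3 = 4 * 2 ^+ t.*2.+1 :> R); last by rewrite !exprS; ring.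
rewrite invfM mulrA ler_pM2r ?invr_gt0 ?exprn_gt0// ler_pdivlMr//.
by rewrite -natrM ler_nat mulnC leq_stage.
Qed.

Lemma approx_measure_cvg E :
  (approx_measure t E)%:E @[t --> \oo] --> optimal_measure E.
Proof.
apply: ereal_nondecreasing_cvgn => s t st.
by rewrite lee_fin approx_measure_nd.
Qed.

Lemma approx_measure_le t E : ((approx_measure t E)%:E <= optimal_measure E)%E.
Proof. by apply: ereal_sup_ubound; exists t. Qed.

Lemma approx_measure_ge0 t E : 0 <= approx_measure t E.
Proof. by rewrite divr_ge0 ?exprn_ge0. Qed.

Lemma optimal_measure_ge0 E : (0 <= optimal_measure E)%E.
Proof. by rewrite (le_trans _ (approx_measure_le 0 E))// lee_fin approx_measure_ge0. Qed.

Lemma optimal_measure_eq0 E : (forall q, ~ E (ratpoint R q)) -> optimal_measure E = 0%E.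
Proof.
move=> E0; apply/eqP; rewrite eq_le optimal_measure_ge0 andbT.
apply: ge_ereal_sup => _ [t _ <-]; rewrite /approx_measure stage0 ?mul0r// => d _.
by apply/asboolPn; exact: E0.
Qed.

Lemma optimal_measure0 : optimal_measure set0 = 0%E.
Proof. by apply: optimal_measure_eq0 => q; case. Qed.

Lemma le_optimal_measure : {homo optimal_measure : A B / A `<=` B >-> (A <= B)%E}.
Proof.
move=> A B AB; apply: ge_ereal_sup => _ [t _ <-].
apply: le_trans (approx_measure_le t B); rewrite lee_fin.
rewrite ler_pM2r ?invr_gt0 ?exprn_gt0// ler_nat stage_subset// => d _ /asboolP/AB H.
exact/asboolP.
Qed.

(** Stage [t] sees only points with codes below [t], so finitely many members of the sequence cover
    what it sees of the union, and finite subadditivity of the stage suffices. *)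
Lemma optimal_measure_sigma_subadditive : sigma_subadditive optimal_measure.
Proof.
move=> F; apply: ge_ereal_sup => _ [t _ <-].
have [K HK] : exists K, forall d, (d < t)%N -> codes (\bigcup_k F k) d ->
    has_lt K (fun k => codes (F k) d).
  have /choice[N HN] : forall d, exists k, codes (\bigcup_k F k) d -> codes (F k) d.
    move=> d; have [/asboolP[k _ Fk]|H] := boolP (codes (\bigcup_k F k) d).
      by exists k => _; exact/asboolP.
    by exists 0%N.
  exists (\max_(d < t) N d).+1 => d dt /HN H; apply/has_ltP; exists (N d) => //.
  by rewrite ltnS (leq_bigmax (Ordinal dt)).
apply: le_trans (nneseries_lim_ge K _); last by move=> *; exact: optimal_measure_ge0.
apply: (@le_trans _ _ (\sum_(0 <= k < K) (approx_measure t (F k))%:E)%E).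
  rewrite sumEFin lee_fin /approx_measure -mulr_suml -natr_sum.
  rewrite ler_pM2r ?invr_gt0 ?exprn_gt0// ler_nat.
  by apply: leq_trans (stage_bigU _ _ _ _); exact: stage_subset.
by apply: lee_sum => k _; exact: approx_measure_le.
Qed.

End OptimalMeasure.

HB.instance Definition _ (R : realType) n := isOuterMeasure.Build R 'rV[R]_n
  (@optimal_measure R n) (@optimal_measure0 R n) (@optimal_measure_ge0 R n)
  (@le_optimal_measure R n) (@optimal_measure_sigma_subadditive R n).

(** * Point masses and finite support *)

Section StronglyFinite.
Variables (R : realType) (n : nat).
Implicit Types nu : {outer_measure set 'rV[R]_n -> \bar R}.

Let point d : 'rV[R]_n := ratpoint R (ratvec_of_code n d).

Lemma least_code_ex (q : 'rV[rat]_n) :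
  exists2 d, least_code n d & ratvec_of_code n d = q.
Proof.
have ex : exists d, ratvec_of_code n d == q.
  by have [d <-] := ratvec_of_code_surj q; exists d.
case: (ex_minnP ex) => d /eqP dq dmin; exists d => //.
apply/all_ltP => d' d'd; rewrite same_vecE dq; apply/negP => /dmin.
by rewrite leqNgt d'd.
Qed.

Lemma esum_Qn nu : (\esum_(q in @Qn R n) nu [set q] =
  \sum_(d <oo | least_code n d) nu [set point d])%E.
Proof.
rewrite nneseries_esum => [|d _]; last exact: outer_measure_ge0.
apply: (@reindex_esum R nat _ [set d | least_code n d] (@Qn R n) point (fun q => nu [set q])).
split.
- by move=> d _; exists (ratvec_of_code n d).
- move=> c d; rewrite !inE => /all_ltP Cc /all_ltP Cd /ratpoint_inj cd.
  case: (ltngtP c d) => // [/Cd|/Cc]; by rewrite same_vecE cd eqxx.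
- by move=> _ [q _ <-]; have [d dC <-] := least_code_ex q; exists d.
Qed.

(** Off the points with codes below [N] there remain a null set and points of least code at least
    [N]; countable subadditivity bounds the latter by a tail of the convergent series of point
    masses. *)
Lemma strongly_finite_finitely_supported nu :
  strongly_finite nu -> finitely_supported_on_Qn nu.
Proof.
move=> [nuQ]; rewrite esum_Qn => fin eps eps0.
have /fine_cvgP[fN] := nneseries_tail_cvg fin (fun d _ => outer_measure_ge0 nu _).
move=> /cvgr_lt /(_ eps eps0) ltN.
have [N _ /(_ N (leqnn N))[/= fN' ltN']] := filterI fN ltN.
exists [fset x in [seq ratvec_of_code n d | d <- iota 0 N]]%fset.
apply: (@le_lt_trans _ _ (\sum_(N <= k <oo | least_code n k) nu [set point k])%E);
  last by rewrite -(fineK fN') lte_fin; exact: ltN'.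
pose F k := if least_code n k && (N <= k)%N then [set point k] else set0.
have sub : ~` @ratset R n [fset x in [seq ratvec_of_code n d | d <- iota 0 N]]%fset `<=`
    ~` @Qn R n `|` \bigcup_k F k.
  move=> x nAx; have [[q _ qx]|] := pselect (@Qn R n x); last by left.
  right; have [d dC dq] := least_code_ex q.
  exists d => //; rewrite /F dC /=; case: leqP => [_|dN]; first by rewrite /point dq.
  by exfalso; apply: nAx; exists q => //=; rewrite !inE -dq map_f// mem_iota dN.
apply: (le_trans (le_outer_measure nu _ _ sub)).
apply: (le_trans (outer_measureU2 nu _ _)); rewrite nuQ add0e.
apply: (le_trans (outer_measure_sigma_subadditive nu F)).
rewrite [leRHS]eseries_cond [leRHS]eseries_mkcond le_eqVlt; apply/orP; left; apply/eqP.
by apply: eq_eseriesr => k _; rewrite /F; case: ifP.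
Qed.

End StronglyFinite.

(** * Strong finiteness and lower semicomputability *)

Section OptimalMeasureProperties.
Variables (R : realType) (n : nat).

Let mu : {outer_measure set 'rV[R]_n -> \bar R} := @optimal_measure R n.

Lemma optimal_measure_strongly_finite : strongly_finite mu.
Proof.
split; first by apply: optimal_measure_eq0 => q; apply; exists q.
rewrite esum_Qn; apply: (@le_lt_trans _ _ 1%E); last exact: ltry.
apply: lime_le; first by apply: is_cvg_nneseries => d _ _; exact: outer_measure_ge0.
apply: nearW => K.
(* A finite sum of point masses is the limit of the sums at the stages, each at most 1 by
   [stage_mass]. *)
have cvgK : (\sum_(0 <= d < K | least_code n d)
     (approx_measure t [set ratpoint R (ratvec_of_code n d)])%:E @[t --> \oo] -->
   \sum_(0 <= d < K | least_code n d) mu [set ratpoint R (ratvec_of_code n d)])%E.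
  apply: cvg_nnesum => d _; last exact: approx_measure_cvg.
  by apply: nearW => t; rewrite lee_fin approx_measure_ge0.
rewrite -(cvg_lim _ cvgK)//; apply: lime_le; first by apply/cvg_ex; eexists; exact: cvgK.
apply: nearW => t; rewrite sumEFin lee_fin /approx_measure -mulr_suml -natr_sum.
rewrite ler_pdivrMr ?exprn_gt0// mul1r -natrX ler_nat.
apply: leq_trans (stage_mass n t K); rewrite big_mkcond; apply: leq_sum => d _.
case: ifP => // _; rewrite mul1n; apply: stage_subset => c _ /asboolP/ratpoint_inj.
by rewrite same_vecE => ->.
Qed.

Definition optimal_approx (A : {fset 'rV[rat]_n}) t : rat :=
  (stage n t (fun d => ratvec_of_code n d \in A))%:R / 2 ^+ t.*2.+1.

Lemma ratr_optimal_approx A t :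
  ratr (optimal_approx A t) = approx_measure t (@ratset R n A).
Proof.
rewrite /optimal_approx fmorph_div rmorphXn/= !ratr_nat; congr (_%:R / _).
apply/eqP; rewrite eqn_leq; apply/andP; split; apply: stage_subset => d _.
  by move=> dA; apply/asboolP; exists (ratvec_of_code n d).
by move=> /asboolP[q qA /ratpoint_inj <-].
Qed.

Lemma computable_optimal_approx : computable optimal_approx.
Proof.
(* The triple consists of the numerator, the subtrahend 0 and the predecessor of the denominator. *)
exists (fun v : 2.-tuple nat => CodeSeq.code
  [:: stage n (nth 0 v 1)%N (fun d => mem_code n d (nth 0 v 0)%N); 0;
      (2 ^ (2 * nth 0 v 1).+1).-1]%N).
  apply: (_ : Rec (fun v => CodeSeq.code
    [:: stage n (nth 0 v 1) (fun d => mem_code n d (nth 0 v 0)); 0;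
      (2 ^ (2 * nth 0 v 1).+1).-1])%N).
  apply: (@eq_Rec (fun s => ccons (stage n (nth 0 s 1) (fun d => mem_code n d (nth 0 s 0)))
      (ccons 0 (ccons (2 ^ (2 * nth 0 s 1).+1).-1 0)))%N) => [s|].
    by rewrite (ccons_code _ [::]) !ccons_code.
  by have := Rec_stage; rec.
move=> a t /=; rewrite /rat_of_code CodeSeq.codeK /= subr0 /optimal_approx.
rewrite prednK ?expn_gt0// mul2n natrX; congr (_%:R / _).
by apply/eqP; rewrite eqn_leq; apply/andP; split; apply: stage_subset => d _;
  rewrite mem_codeE.
Qed.

Lemma optimal_measure_lower_semicomputable : lower_semicomputable mu.
Proof.
split; first exact/strongly_finite_finitely_supported/optimal_measure_strongly_finite.
exists optimal_approx; split.
- exact: computable_optimal_approx.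
- by move=> A t; rewrite divr_ge0 ?exprn_ge0.
- move=> A s t st; rewrite -(ler_rat R) !ratr_optimal_approx; split.
    exact: approx_measure_nd.
  exact: approx_measure_le.
- move=> A; under eq_fun do rewrite ratr_optimal_approx.
  exact: approx_measure_cvg.
Qed.

End OptimalMeasureProperties.

(** * Optimality *)

Lemma cover_min_le_mask n e t m (D : pred nat) : (m < 2 ^ t)%N ->
  (forall d, (d < t)%N -> D d -> bit d m) ->
  (cover_min n e t D <= mask_approx n e t m)%N.
Proof.
move=> mt Dm; apply: leq_trans (@cover_min_le n e t D (pred1 m) _) _.
  by move=> d dt /(Dm d dt) dm; exists m; rewrite //= eqxx.
rewrite big_mkord (bigD1 (Ordinal mt))//= eqxx mul1n big1 ?addn0// => i.
by rewrite -val_eqE /= => /negbTE ->; rewrite mul0n.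
Qed.

Lemma leq_mask_approx_fact n e t m w x y : (w < t)%N -> valid w ->
  shows w (cnth e 0) x y -> csize x = 2%N -> (0 < cnth x 0)%N ->
  sub_mask n t m (cnth x 0) -> (scaled t (cnth e 1) y <= mask_approx n e t m)%N.
Proof.
move=> wt V /showsP[j jw [E0 E1 E2]] x2 x0 xm.
rewrite /mask_approx big_mkord; apply: leq_trans (leq_bigmax (Ordinal wt)) => /=.
rewrite big_mkord; apply: leq_trans (leq_bigmax (Ordinal jw)) => /=.
by rewrite E0 E1 E2 V x2 !eqxx x0 xm.
Qed.

Lemma outer_measure_ratset (R : realType) n (nu : {outer_measure set 'rV[R]_n -> \bar R})
    (A : {fset 'rV[rat]_n}) :
  strongly_finite nu -> nu (@ratset R n A) \is a fin_num.
Proof.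
move=> [_ fin]; rewrite ge0_fin_numE ?outer_measure_ge0//.
pose F i : set 'rV[R]_n := [set @ratpoint R n (nth 0 A i)].
have AF : @ratset R n A `<=` \big[setU/set0]_(i < size A) F i.
  move=> _ [q qA <-]; rewrite -bigcup_mkord; exists (index q A) => /=.
    by rewrite index_mem.
  by rewrite /F nth_index.
apply: le_lt_trans (le_outer_measure nu _ _ AF) _.
apply: le_lt_trans (outer_measure_subadditive nu F (size A)) _.
apply: lte_sum_pinfty => i _; apply: le_lt_trans fin; apply: esum_ge.
exists (F i); last by rewrite fsbig_set1.
by split; [exact: finite_set1|move=> _ ->; exists (nth 0 A i)].
Qed.

Lemma outer_measure_mass (R : realType) n (nu : {outer_measure set 'rV[R]_n -> \bar R}) :
  strongly_finite nu -> exists k, forall K, (\sum_(0 <= d < K | least_code n d)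
    nu [set ratpoint R (ratvec_of_code n d)] <= (2 ^ k)%:R%:E)%E.
Proof.
move=> [_]; rewrite esum_Qn; set M := (X in (X < _)%E) => fin.
have M0 : (0 <= M)%E by apply: nneseries_ge0 => *; exact: outer_measure_ge0.
have Mfin : M \is a fin_num by rewrite ge0_fin_numE.
(* An archimedean bound b of the total mass serves as exponent because b < 2^b. *)
exists (Num.bound (fine M)) => K.
apply: le_trans (nneseries_lim_ge K _) _; first by move=> *; exact: outer_measure_ge0.
rewrite -/M -(fineK Mfin) lee_fin ltW// (lt_le_trans (archi_boundP _))// ?fine_ge0//.
by rewrite ler_nat ltnW// ltn_expl.
Qed.

(** * The index of a program approximating a given outer measure *)

Section Optimality.
Variables (R : realType) (n : nat) (nu : {outer_measure set 'rV[R]_n -> \bar R}).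
Variables (nuhat : {fset 'rV[rat]_n} -> nat -> rat) (f : 2.-tuple nat -> nat) (p k : nat).

Hypothesis nu_fin : forall A : {fset 'rV[rat]_n}, nu (ratset A) \is a fin_num.
Hypothesis nu_mass : forall K, (\sum_(0 <= d < K | least_code n d)
  nu [set ratpoint R (ratvec_of_code n d)] <= (2 ^ k)%:R%:E)%E.
Hypothesis nuhat_ge0 : forall A t, 0 <= nuhat A t.
Hypothesis nuhat_le : forall A t, ((ratr (nuhat A t) : R)%:E <= nu (ratset A))%E.
Hypothesis nuhat_cvg : forall A, (ratr (nuhat A t) : R)%:E @[t --> \oo] --> nu (ratset A).
Hypothesis fE : forall a t, rat_of_code (f [tuple a; t]) = nuhat (ratset_of_code n a) t.
Hypothesis pf : implements p f.

Let e := CodeSeq.code [:: p; k].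
Let value (A : {fset 'rV[rat]_n}) : R := fine (nu (ratset A)).

Let valueE A : nu (ratset A) = (value A)%:E.
Proof. by rewrite fineK. Qed.

Let value_ge0 A : 0 <= value A.
Proof. by rewrite -lee_fin -valueE outer_measure_ge0. Qed.

(** Soundness of derivations: each fact that counts is a true value of [f], hence a lower bound for
    [nu] on a set contained in the mask, and [nu] is monotone. *)
Lemma mask_approx_le t m A :
  (forall d, (d < t)%N -> bit d m -> ratvec_of_code n d \in A) ->
  (mask_approx n e t m * 2 ^ k)%:R <= 2 ^+ t * value A.
Proof.
move=> mA; pose P x := (x * 2 ^ k)%:R <= 2 ^+ t * value A.
have P0 : P 0%N by rewrite /P mul0n mulr_ge0 ?exprn_ge0.
have Pmax x y : P x -> P y -> P (maxn x y) by rewrite /P /maxn; case: ifP.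
rewrite /mask_approx big_nat; apply: (big_ind P) => // w /andP[_ wt].
rewrite big_nat; apply: (big_ind P) => // j /andP[_ jw].
rewrite !cnth_code /=; case: ifP => // /and5P[V /eqP E0 /eqP x2 _ Sm].
set y := cnth (cnth w j) 2; set x := cnth (cnth w j) 1 in x2 Sm.
have xE : x = CodeSeq.code [tuple cnth x 0; cnth x 1].
  rewrite -[LHS]CodeSeq.decodeK; congr CodeSeq.code; move: x2; rewrite /csize /cnth.
  by case: (CodeSeq.decode x) => [|a [|b []]].
have yE : y = f [tuple cnth x 0; cnth x 1].
  by apply: pf.2 V _; rewrite -xE; apply/showsP; exists j.
have yv : ratr (rat_of_code y) <= value A.
  rewrite yE fE -lee_fin -valueE (le_trans (nuhat_le _ _))// le_outer_measure//.
  move=> _ [q /= qx <-]; exists q => //=.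
  by have [d dt /andP[dm /eqP <-]] := sub_maskP Sm qx; exact: mA.
apply: (@le_trans _ _ (2 ^+ t * ratr (rat_of_code y))); last by rewrite ler_pM2l ?exprn_gt0.
have : 0 <= rat_of_code y by rewrite yE fE.
move=> /(scaled_le t k).
rewrite -(ler_rat R) ratr_nat [ratr (_ * _)]rmorphM/= rmorphXn/= ratr_nat; exact.
Qed.

(** One mask, holding all codes below [s] of a point, covers its singleton; so each cover value is
    at most the mass of the point divided by 2^k, and [nu_mass] bounds the sum. *)
Lemma all_good s : good n e s.
Proof.
rewrite /good -(leq_pmul2r (expn_gt0 2 k)) -(ler_nat R) natrM natr_sum mulr_suml.
apply: (@le_trans _ _ (\sum_(0 <= d < s | least_code n d)
    2 ^+ s * value [fset ratvec_of_code n d]%fset)).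
  rewrite [leRHS]big_mkcond/=; apply: ler_sum => d _; case: ifP => _;
    last by rewrite mul0n mul0r.
  rewrite mul1n; have [m mt mb] := ex_bits s (same_vec n^~ d).
  apply: le_trans (@mask_approx_le s m _ _); last first.
    by move=> c cs; rewrite mb// same_vecE inE.
  rewrite -natrM ler_nat leq_mul2r; apply/orP; right; apply: cover_min_le_mask => // c cs.
  by rewrite mem_code1 mb.
rewrite -mulr_sumr natrM natrX ler_pM2l ?exprn_gt0//.
rewrite -lee_fin -sumEFin; apply: le_trans (nu_mass s).
apply: lee_sum => d _; rewrite -valueE le_outer_measure// => _ [q /= + <-].
by rewrite inE => /eqP ->.
Qed.

(** A late approximation exceeds three quarters of [value C], and rounding loses at most one quarter
    once the unit is small. The remaining half accounts for [k.+1]; the threshold depends on [C] but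
    not on the mask. *)
Lemma mask_approx_ge (C : {fset 'rV[rat]_n}) : exists T, forall t m, (T <= t)%N ->
  (forall q, q \in C -> exists2 d, (d < t)%N & bit d m && (ratvec_of_code n d == q)) ->
  2 ^+ t * value C <= (mask_approx n e t m * 2 ^ k.+1)%:R.
Proof.
have [C0|C_neq0] := eqVneq (value C) 0; first by exists 0%N => t m _ _; rewrite C0 mulr0.
have C_gt0 : 0 < value C by rewrite lt_def C_neq0 value_ge0.
have [a aC] := ratset_of_code_surj C.
have a_gt0 : (0 < a)%N.
  rewrite lt0n; apply: contra_neq C_neq0 => a0; rewrite /value.
  rewrite (_ : ratset C = set0) ?outer_measure0//.
  by rewrite -subset0 => _ [q /= + _]; rewrite -aC a0 !inE.
have [s sC] : exists s, value C * (3 / 4) < ratr (nuhat C s).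
  have := @nuhat_cvg C; rewrite valueE => /fine_cvgP[_] /cvgr_gt/(_ (value C * (3 / 4))).
  case=> [|N _ /(_ N (leqnn N))]; last by exists N.
  by rewrite -[ltRHS]mulr1 ltr_pM2l//; lra.
have [w V S] := pf.1 [tuple a; s].
(* From stage [B] on, 2^k is at most a quarter of 2^t [value C], which is the rounding loss. *)
pose B := Num.bound (2 ^+ k.+2 / value C).
exists (maxn w.+1 B) => t m; rewrite geq_max => /andP[wt Bt] Cm.
pose y := f [tuple a; s]; pose x := CodeSeq.code [tuple a; s].
have Ht : 2 ^+ k.+2 <= 2 ^+ t * value C.
  rewrite -ler_pdivrMr//; apply: le_trans (ltW (archi_boundP _)) _.
    by rewrite divr_ge0 ?exprn_ge0// ltW.
  by rewrite -[leRHS]natrX ler_nat (leq_trans Bt)// ltnW// ltn_expl.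
have H1 : (scaled t k y <= mask_approx n e t m)%N.
  have := @leq_mask_approx_fact n e t m w x y wt V; rewrite !cnth_code /=; apply => //.
    by rewrite csize_code.
  apply/all_ltP => i ia; apply/has_ltP.
  have /Cm[d dt /andP[dm /eqP dq]] : ratvec_of_code n (cnth a i) \in C.
    by rewrite -aC !inE map_f// mem_nth.
  by exists d; rewrite // dm same_vecE dq eqxx.
have H2 : 2 ^+ t * (value C * (3 / 4)) <= ((scaled t k y).+1 * 2 ^ k)%:R.
  apply: (@le_trans _ _ (2 ^+ t * ratr (nuhat C s))).
    by rewrite ler_pM2l ?exprn_gt0// ltW.
  have := scaled_gt t k y; rewrite /y fE aC -(ltr_rat R)
     ratr_nat [ratr (_ * _)]rmorphM/= rmorphXn/= ratr_nat.
  exact: ltW.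
apply: (@le_trans _ _ (scaled t k y * 2 ^ k.+1)%:R); last by rewrite ler_nat leq_mul2r H1 orbT.
move: Ht H2; rewrite !natrM -natr1 !natrX !exprS; nra.
Qed.

(** The traces on [A] of the masks in an optimal cover are among the finitely many subsets of [A],
    so one late stage serves them all, however many masks there are; subadditivity of [nu] then
    bounds the sum. *)
Lemma cover_min_ge (A : {fset 'rV[rat]_n}) : exists2 t, (e < t)%N &
  2 ^+ t * value A <= (cover_min n e t (fun d => ratvec_of_code n d \in A) * 2 ^ k.+1)%:R.
Proof.
have /choice[T TP] := mask_approx_ge.
have /choice[c cP] := @ratvec_of_code_surj n.
(* Beyond the thresholds of all subsets of [A], beyond a code of each of its points, and beyond
   [e]. *)
pose t := (\max_(C <- fpowerset A) T C + \max_(q <- A) c q + e).+1.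
exists t; first by rewrite ltnS leq_addl.
have tT C : (C `<=` A)%fset -> (T C <= t)%N.
  move=> CA; rewrite leqW// -addnA (leq_trans _ (leq_addr _ _))//.
  by apply: leq_bigmax_seq => //; rewrite fpowersetE.
have tc q : q \in A -> (c q < t)%N.
  move=> qA; rewrite ltnS -addnA (leq_trans _ (leq_addl _ _))// (leq_trans _ (leq_addr _ _))//.
  exact: leq_bigmax_seq.
have [B AB ->] := cover_min_ex n e t (fun d => ratvec_of_code n d \in A).
pose C m := [fset q in A | has_lt t (fun d => bit d m && (ratvec_of_code n d == q))]%fset.
pose F m := if B m then @ratset R n (C m) else set0.
have AF : @ratset R n A `<=` \big[setU/set0]_(m < 2 ^ t) F m.
  move=> _ [q /= qA <-]; have [|m mt /andP[Bm qm]] := AB (c q) (tc q qA); first by rewrite cP.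
  rewrite -bigcup_mkord; exists m => //; rewrite /F Bm; exists q => //=.
  by rewrite !inE qA /=; apply/has_ltP; exists (c q); rewrite ?tc// qm cP eqxx.
have val_le : value A <= \sum_(m < 2 ^ t) if B m then value (C m) else 0.
  rewrite -lee_fin -valueE -sumEFin; apply: le_trans (le_outer_measure nu _ _ AF) _.
  apply: le_trans (outer_measure_subadditive nu F _) _; apply: lee_sum => m _.
  by rewrite /F; case: ifP => _; rewrite ?valueE ?outer_measure0.
rewrite big_mkord natrM natr_sum mulr_suml.
apply: (@le_trans _ _ (\sum_(m < 2 ^ t) 2 ^+ t * if B m then value (C m) else 0)).
  by rewrite -mulr_sumr ler_pM2l ?exprn_gt0.
apply: ler_sum => m _; case: ifP => _; last by rewrite mulr0 mul0n mul0r.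
rewrite mul1n -natrM; apply: TP => [|q]; first by apply: tT; exact: fset_sub.
by rewrite !inE => /andP[_ /has_ltP].
Qed.

(** The exponent collects [e] from the weight, 1 from the normalization in [approx_measure], [k]
    from the scaling and 1 from the half lost in [cover_min_ge]. *)
Lemma optimal_measure_ge_ratset (A : {fset 'rV[rat]_n}) :
  ((2 ^+ (e + k.+2))^-1%:E * nu (ratset A) <= optimal_measure (ratset A))%E.
Proof.
have [t et H] := cover_min_ge A.
apply: le_trans (approx_measure_le t _); rewrite -ratr_optimal_approx valueE -EFinM lee_fin.
rewrite fmorph_div rmorphXn/= !ratr_nat ler_pdivlMr ?exprn_gt0// -mulrA.
rewrite ler_pdivrMl ?exprn_gt0//.
have := @stage_good n e t (fun d => ratvec_of_code n d \in A) all_good et.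
rewrite -(ler_nat R) natrM natrX => /(ler_wpM2l (exprn_ge0 (e + k.+2) (ler0n R 2))).
apply: le_trans; rewrite mulrA -exprD addnAC subnKC ?(ltnW et)// -addSnnS exprD -mulrA.
move: H; rewrite natrM natrX (mulrC _ (2 ^+ k.+1)).
move=> /(ler_wpM2l (exprn_ge0 t.+1 (ler0n R 2))); apply: le_trans.
by rewrite mulrA -exprD -addnn -addSn mulrC.
Qed.

End Optimality.

(** Finite support of [nu] replaces [E] by its trace on a finite set [A0], up to the complement of
    [A0]. *)
Lemma dominates_of_ratset (R : realType) n
    (mu nu : {outer_measure set 'rV[R]_n -> \bar R}) (beta : R) : 0 < beta ->
  finitely_supported_on_Qn nu ->
  (forall A : {fset 'rV[rat]_n}, (beta%:E * nu (ratset A) <= mu (ratset A))%E) ->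
  forall E, (beta%:E * nu E <= mu E)%E.
Proof.
move=> b0 nufin H E; apply/lee_addgt0Pr => eps eps0.
(* The bound eps / beta makes the loss [eps] after multiplication by [beta]. *)
have [A0 A0eps] := nufin _ (divr_gt0 eps0 b0).
pose A := [fset q in A0 | `[< E (@ratpoint R n q) >]]%fset.
have EA : E `<=` @ratset R n A `|` ~` @ratset R n A0.
  move=> x Ex; have [[q /= qA0 qx]|] := pselect (@ratset R n A0 x); last by right.
  by left; exists q => //=; rewrite !inE qA0; apply/asboolP; rewrite qx.
have AE : @ratset R n A `<=` E.
  by move=> _ [q /= + <-]; rewrite !inE => /andP[_ /asboolP].
have b0' : (0 <= beta%:E)%E by rewrite lee_fin ltW.
apply: (@le_trans _ _ (beta%:E * (nu (ratset A) + nu (~` ratset A0)))%E).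
  apply: lee_wpmul2l => //; apply: le_trans (outer_measureU2 nu _ _).
  exact: le_outer_measure.
rewrite ge0_muleDr ?outer_measure_ge0//; apply: leeD.
  exact: le_trans (H A) (le_outer_measure mu _ _ AE).
rewrite -(mulfVK (lt0r_neq0 b0) eps) mulrC EFinM.
by apply: lee_wpmul2l => //; exact: ltW.
Qed.

Theorem theorem3p6 (R : realType) (n : nat) (n_ge1 : (1 <= n)%N) :
  exists mu : {outer_measure set 'rV[R]_n -> \bar R}, globally_optimal mu.
Proof.
exists (@optimal_measure R n); split.
- exact: optimal_measure_strongly_finite.
- exact: optimal_measure_lower_semicomputable.
move=> nu nu_sf [nu_fs [nuhat [[f f_rec fE] nuhat_ge0 nuhat_le nuhat_cvg]]].
have [k nu_mass] := outer_measure_mass nu_sf.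
have [p pf] := recursive_implements f_rec.
exists (2 ^+ (CodeSeq.code [:: p; k] + k.+2))^-1; first by rewrite invr_gt0 exprn_gt0.
apply: dominates_of_ratset => // A.
apply: (@optimal_measure_ge_ratset R n nu nuhat f p k) => // [B|B t].
- exact: outer_measure_ratset.
- by have [] := nuhat_le B t t (leqnn t).
Qed.
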